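(* Let $k$ be a positive integer and let $\lambda\in\mathrm{sP}_\ell^k$ be a strictly decreasing $k$-bounded partition of length $\ell$. Then the coefficients $a_{\lambda\mu}$ in the expansion $$\tilde{\mathfrak g}^{(k)}_\lambda=\sum_{\mu}a_{\lambda\mu}\,\tilde{\mathfrak g}^{(k+1)}_\mu,$$ where $\mu$ runs over $(k+1)$-bounded partitions, satisfy $(-1)^{|\lambda|-|\mu|}a_{\lambda\mu}\in\mathbb{Z}_{\ge0}$ for all $\mu$.
   Context: $h_d$ is the complete homogeneous symmetric function. For $m\in\mathbb{Z}$, $r\in\mathbb{Z}_{\ge0}$ put $k_m^{(r)}:=\sum_{i=0}^{m}\binom{r+i-1}{i}h_{m-i}$, with $k_m^{(r)}=0$ for $m<0$ and $k_m^{(0)}=h_m$. For $\gamma\in\mathbb{Z}^\ell$ let $k_\gamma:=k^{(0)}_{\gamma_1}k^{(1)}_{\gamma_2}\cdots k^{(\ell-1)}_{\gamma_\ell}$ and $g_\gamma:=\det(k^{(i-1)}_{\gamma_i+j-i})_{1\le i,j\le\ell}$. Let $\epsilon_i\in\mathbb{Z}^\ell$ be the $i$-th unit vector and $\Delta_\ell^+:=\{(i,j):1\le i<j\le\ell\}$. A root ideal is a subset $\Psi\subseteq\Delta_\ell^+$ such that $(a,b)\in\Psi$, $(c,d)\in\Delta_\ell^+$, $c\le a$, $d\ge b$ imply $(c,d)\in\Psi$. For a root ideal $\Psi$, a finite multiset $M$ supported in $[\ell]=\{1,\dots,\ell\}$ and $\gamma\in\mathbb{Z}^\ell$, the Katalan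 function is $$K(\Psi;M;\gamma):=\prod_{z\in M}(1-L_z)\prod_{(i,j)\in\Psi}(1-R_{ij})^{-1}g_\gamma=\prod_{z\in M}(1-L_z)\prod_{(i,j)\in\Delta_\ell^+\setminus\Psi}(1-R_{ij})\,k_\gamma,$$ where $L_z$ and $R_{ij}$ act on subscripts: $L_zg_\gamma=g_{\gamma-\epsilon_z}$, $R_{ij}g_\gamma=g_{\gamma+\epsilon_i-\epsilon_j}$, and likewise on $k_\gamma$ (products of operators are expanded first, then applied to the subscript). For a positive integer $k$, a partition is $k$-bounded if all its parts are $\le k$. $\mathrm{P}_\ell^k$ is the set of $k$-bounded partitions of length $\ell$, written as sequences $k\ge\lambda_1\ge\dots\ge\lambda_\ell\ge0$, and $\mathrm{sP}_\ell^k:=\{\lambda\in \mathrm{P}_\ell^k:\lambda_x>\lambda_{x+1}\ \forall x\in[\ell-1]\}$ (with the convention $\mathrm{sP}_0^k=\mathrm{P}_0^k=\emptyset$). For $\lambda\in\mathrm{P}_\ell^k$ let $\Delta^k(\lambda):=\{(i,j)\in\Delta_\ell^+: k-\lambda_i+i<j\}$ (a root ideal) and let $L(\Delta^k(\lambda))$ be the multiset of second components $j$ of the elements $(i,j)\in\Delta^k(\lambda)$. The closed $k$-Schur Katalan function is $\tilde{\mathfrak g}^{(k)}_\lambda:=K\big(\Delta^k(\lambda);L(\Delta^k(\lambda));\lambda\big)$; appending trailing zeros to $\lambda$ does not change it. For each positive integer $k$, the $\tilde{\mathfrak g}^{(k)}_\mu$, with $\mu$ ranging over all $k$-bounded partitions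 (of any length, trailing zeros ignored), form a basis of $\Lambda_{(k)}=\mathbb{Q}[h_1,\dots,h_k]$; note $\Lambda_{(k)}\subset\Lambda_{(k+1)}$. $|\mu|$ denotes the sum of the parts. *)

(* Defs.v *)
From mathcomp Require Import all_boot all_order all_algebra.
From mathcomp Require Import finmap mpoly.

Set Implicit Arguments.
Unset Strict Implicit.
Unset Printing Implicit Defensive.

Import Order.TTheory GRing.Theory Num.Theory.

Local Open Scope ring_scope.

(* A symmetric function over Q is handled through its restrictions to n       *)
(* variables: f is given by the family of polynomials f(x_0, .., x_(n-1)),    *)
(* n : nat, and an identity in the ring of symmetric functions is the same    *)
(* identity in n variables for every n (restriction is a ring morphism, and   *)
(* a symmetric function is determined by all of its restrictions).            *)

(* Complete homogeneous symmetric function, restricted to n variables. *)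
Definition hsym (n d : nat) : {mpoly rat[n]} :=
  \sum_(m : 'X_{1..n < d.+1} | mdeg m == d) 'X_[m].

(* For r = 0 the truncated r + i - 1 gives 'C(0, 0) = 1 at i = 0 and          *)
(* 'C(i.-1, i) = 0 for i > 0, so that kfun n 0 m = hsym n m.                  *)
Definition kfun (n r : nat) (m : int) : {mpoly rat[n]} :=
  match m with
  | Posz d => \sum_(i < d.+1) hsym n (d - i)%N *+ 'C((r + i).-1%N, i)
  | Negz _ => 0
  end.

(* Subscripts are indexed from 0, so the factor at i carries exponent r = i.  *)
Definition kvec (n l : nat) (g : 'rV[int]_l) : {mpoly rat[n]} :=
  \prod_(i < l) kfun n i (g 0 i).

Definition eps (l : nat) (i : 'I_l) : 'rV[int]_l := delta_mx 0 i.

(* Operators on subscripts act on functions of the subscript; these shifts    *)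
(* commute, and a composite of them evaluated at g is the product of the      *)
(* operators, expanded and then applied to the subscript g.                   *)
Definition one_sub_L (V : zmodType) (l : nat) (z : 'I_l)
    (F : 'rV[int]_l -> V) (g : 'rV[int]_l) : V :=
  F g - F (g - eps z).

Definition one_sub_R (V : zmodType) (l : nat) (p : 'I_l * 'I_l)
    (F : 'rV[int]_l -> V) (g : 'rV[int]_l) : V :=
  F g - F (g + eps p.1 - eps p.2).

Definition Delta_plus (l : nat) : {set 'I_l * 'I_l} :=
  [set p : 'I_l * 'I_l | (p.1 < p.2)%N].

(* The Katalan function K(Psi; M; g) in n variables, in its form with the     *)
(* finite product over Delta_plus minus Psi; the multiset M is a sequence.    *)
Definition Katalan (n l : nat) (Psi : {set 'I_l * 'I_l}) (M : seq 'I_l)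
    (g : 'rV[int]_l) : {mpoly rat[n]} :=
  foldr (@one_sub_L _ l)
    (foldr (@one_sub_R _ l) (@kvec n l) (enum (Delta_plus l :\: Psi))) M g.

(* The condition k - s_i + i < j is invariant under the shift of the indices  *)
(* by one; the natural subtraction is exact since s is k-bounded.             *)
Definition Delta_k (k : nat) (s : seq nat) :
    {set 'I_(size s) * 'I_(size s)} :=
  [set p in Delta_plus (size s) | (k - nth 0 s p.1 + p.1 < p.2)%N].

(* The closed k-Schur Katalan function of s, in n variables. *)
Definition closed_kschur (n k : nat) (s : seq nat) : {mpoly rat[n]} :=
  Katalan n (Delta_k k s) [seq p.2 | p <- enum (Delta_k k s)]
    (\row_i (nth 0%N s i)%:Z).

(* k-bounded partitions of length l, trailing zeros allowed. *)
Definition in_P (k l : nat) (s : l.-tuple nat) : bool :=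
  [&& (0 < l)%N, all (fun p => p <= k)%N s & sorted geq s].

Definition in_sP (k l : nat) (s : l.-tuple nat) : bool :=
  in_P k s && [forall x : 'I_l, forall y : 'I_l,
    (y == x.+1 :> nat) ==> (tnth s y < tnth s x)%N].

(* k-bounded partitions of any length, trailing zeros ignored: each one is    *)
(* represented by the sequence of its nonzero parts.                          *)
Definition is_bpart (k : nat) (s : seq nat) : bool :=
  all (fun p => 0 < p <= k)%N s && sorted geq s.

Definition bpart (k : nat) : choiceType := {s : seq nat | is_bpart k s}.

(* f, given in n variables for every n, equals the sum of the a(mu) times the *)
(* closed k-Schur Katalan functions of mu, as symmetric functions.            *)
Definition kschur_expansion (k : nat) (f : forall n : nat, {mpoly rat[n]})
    (a : {fsfun bpart k -> rat with 0}) : Prop :=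
  forall n : nat,
    f n = \sum_(mu <- finsupp a) a mu *: closed_kschur n k (val mu).

(* Main.v *)
Require Import Defs.
From mathcomp Require Import all_boot all_order all_fingroup all_algebra all_field.
From mathcomp Require Import finmap mpoly ring zify.

Set Implicit Arguments.
Unset Strict Implicit.
Unset Printing Implicit Defensive.

Import Order.TTheory GRing.Theory Num.Theory.

Local Open Scope ring_scope.

(** Write [L_z] and [R_ij] for the operators on subscripts.  A closed k-Schur
    Katalan function carries one factor [1 - L_j] for each root [(i, j)] and one
    factor [1 - R_ij] for each non-root, so it is a product over all pairs
    [i < j] applied to [k_gamma].  [closedK K d g] is this product with the
    roots read off a shape [d], namely [(i, j)] with [K - d_i + i < j], and
    evaluated at an independent subscript [g].  Put [G d = closedK K d d]; for a
    partition [d] this is the closed K-Schur Katalan function of [d].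

    With [K = k + 1], the shape [lam + 1] has the same roots as [lam] at level
    [k], so the function to be expanded is [closedK K (lam + 1) lam], that is
    [L_0 ... L_(l-1)] applied to [G (lam + 1)].  The parts are lowered one at a
    time, from the last row to the first ([sign_expands_strict]); what has to be
    shown is that [L_z (G kap)] is an alternating sum of functions [G m] as soon
    as [kap_z > kap_(z+1)] ([sign_expands_lower]).  Strictness of [lam] makes
    this inequality hold whenever row [z] is reached, because the rows below it
    have only been lowered, while row [z] still has its part [lam_z + 1].

    Lowering row [z] moves its first root [(z, c)] among the non-roots, and the
    two kinds of factors combine into ([closedK_lower])
      [L_z (G kap) = G (kap - e_z) - L_c (G (kap - e_z)) + L_c (G kap)].
    Every sign agrees with the drop in degree and [c > z], so induction applies
    when [kap_c > kap_(c+1)].  If [kap_c = kap_(c+1)], applying the identity to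
    [L_c] creates subscripts that are not partitions.  The product of the
    factors is symmetric in two adjacent rows with equal non-root ranges, up to
    one factor; this straightens a subscript [(m - 1, m)]
    ([closedK_straighten0], [closedK_straighten1]) and shows that the
    non-partition terms coming from [L_c (G kap)] and [L_c (G (kap - e_z))] are
    equal ([closedK_bounce]).  They cancel, and both terms move on to the
    column [bot c] where row [c] has its first root.  So one follows the chain
    [c, bot c, bot (bot c), ...] until a strict descent is met or the columns
    are exhausted.

    For uniqueness, the complete symmetric functions are specialised to
    [h_d = t ^ phi d] with [phi d = B ^ K - B ^ (K - d)], which is strictly
    concave.  A factor [R_ij] or [L_j] makes the exponent of the subscript
    smaller, so [G mu] becomes a monic polynomial in [t] whose degree is
    [sum_i phi mu_i] ([closedK_hX_monic]); these degrees are distinct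
    because they encode the multiplicities of the parts in base [B].  The
    specialisation is realised by actual values of the variables: over an
    algebraically closed field the inverse of the generating polynomial of the
    [h_d] is truncated to a polynomial and split into linear factors
    ([hsym_specialize]). *)

(** * Products of difference operators *)

Definition fdiff (U V : zmodType) (v : U) (F : U -> V) (g : U) : V :=
  F g - F (g + v).

Definition fdiffs (U V : zmodType) (vs : seq U) (F : U -> V) : U -> V :=
  foldr (@fdiff U V) F vs.
Arguments fdiffs : simpl never.

Section Differences.
Variables U V : zmodType.
Implicit Types (F : U -> V) (vs ws : seq U) (u v g : U).

Lemma fdiffs_cons v vs F g :
  fdiffs (v :: vs) F g = fdiffs vs F g - fdiffs vs F (g + v).
Proof. by []. Qed.

Lemma fdiffs_cat vs ws F g : fdiffs (vs ++ ws) F g = fdiffs vs (fdiffs ws F) g.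
Proof. by rewrite /fdiffs foldr_cat. Qed.

Lemma eq_fdiffs vs F F' : F =1 F' -> fdiffs vs F =1 fdiffs vs F'.
Proof. by move=> eqF; elim: vs => // v vs IH g; rewrite !fdiffs_cons !IH. Qed.

Lemma fdiffs_swap u v vs F g : fdiffs (u :: v :: vs) F g = fdiffs (v :: u :: vs) F g.
Proof.
rewrite !fdiffs_cons [g + v + u]addrAC !opprB !addrA.
by rewrite [LHS]addrAC [RHS]addrAC; congr (_ + _); rewrite addrAC.
Qed.

Lemma fdiffs_rot v vs ws F g :
  fdiffs (vs ++ v :: ws) F g = fdiffs (v :: vs ++ ws) F g.
Proof.
elim: vs g => // w vs IH g; rewrite cat_cons fdiffs_cons !IH -fdiffs_cons.
exact: fdiffs_swap.
Qed.

(** The operators commute, so a product of them can be rearranged at will;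
    every later rewriting of a Katalan function rests on this. *)
Lemma fdiffs_perm vs ws F g : perm_eq vs ws -> fdiffs vs F g = fdiffs ws F g.
Proof.
elim: vs ws g => [|v vs IH] ws g; first by rewrite perm_sym => /perm_nilP ->.
move=> eqvw; have vw: v \in ws by rewrite -(perm_mem eqvw) mem_head.
move: eqvw; case/splitPr: vw => w1 w2 eqvw; rewrite fdiffs_rot !fdiffs_cons.
have eqv: perm_eq vs (w1 ++ w2).
  by rewrite -(perm_cons v) (perm_trans eqvw) // perm_catC /= perm_cons perm_catC.
by rewrite !(IH _ _ eqv).
Qed.

End Differences.

(** Used with [f] a permutation of coordinates and with [f] the deletion of a
    coordinate. *)
Lemma fdiffs_additive (U U' V : zmodType) (f : {additive U -> U'}) (vs : seq U)
    (F : U' -> V) g :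
  fdiffs vs (F \o f) g = fdiffs (map f vs) F (f g).
Proof. by elim: vs g => // v vs IH g; rewrite /= !fdiffs_cons !IH raddfD. Qed.

Lemma fdiffs_raddf (U V W : zmodType) (f : {additive V -> W}) (vs : seq U)
    (F : U -> V) g :
  f (fdiffs vs F g) = fdiffs vs (f \o F) g.
Proof. by elim: vs g => // v vs IH g; rewrite !fdiffs_cons raddfB !IH. Qed.

(** A difference of shifts only sees the values of [F] on any set [P] that
    contains the base point and is stable under the shifts.  The next lemmas
    follow the same principle. *)
Lemma fdiffs_closed (U V : zmodType) (P : U -> Prop) (Q : V -> Prop)
    (vs : seq U) (F : U -> V) g :
  (forall f, P f -> Q (F f)) -> (forall x y, Q x -> Q y -> Q (x - y)) ->
  (forall v f, v \in vs -> P f -> P (f + v)) -> P g -> Q (fdiffs vs F g).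
Proof.
move=> FQ QB; elim: vs g => [|v vs IH] g Pv Pg; first exact: FQ.
have Pvs w f : w \in vs -> P f -> P (f + w).
  by move=> wvs; apply: Pv; rewrite inE wvs orbT.
by rewrite fdiffs_cons; apply: QB; apply: IH => //; apply: Pv; rewrite ?mem_head.
Qed.

Lemma fdiffs_vanish (U V : zmodType) (P : U -> Prop) (vs : seq U) (F : U -> V) g :
  (forall f, P f -> F f = 0) -> (forall v f, v \in vs -> P f -> P (f + v)) ->
  P g -> fdiffs vs F g = 0.
Proof.
move=> F0; apply: (fdiffs_closed (Q := fun x => x = 0)) => // x y -> ->.
by rewrite subr0.
Qed.

Lemma fdiffs_drop (U V : zmodType) (P : U -> Prop) (vs : seq U) (F : U -> V) g :
  (forall f, P f -> F f = 0) -> (forall v f, v \in vs -> P f -> P (f + v)) ->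
  (forall v, v \in vs -> P (g + v)) -> fdiffs vs F g = F g.
Proof.
move=> F0; elim: vs g => [|v vs IH] g Pv Pg //.
have Pvs w f : w \in vs -> P f -> P (f + w).
  by move=> wvs; apply: Pv; rewrite inE wvs orbT.
rewrite fdiffs_cons (@fdiffs_vanish _ _ P _ _ (g + v)) ?subr0 //.
  by apply: IH => // w wvs; apply: Pg; rewrite inE wvs orbT.
by apply: Pg; rewrite mem_head.
Qed.

Lemma eq_fdiffs_in (U V : zmodType) (P : U -> Prop) (vs : seq U) (F F' : U -> V) g :
  (forall f, P f -> F f = F' f) -> (forall v f, v \in vs -> P f -> P (f + v)) ->
  P g -> fdiffs vs F g = fdiffs vs F' g.
Proof.
move=> eqF; elim: vs g => [|v vs IH] g Pv Pg; first exact: eqF.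
have Pvs w f : w \in vs -> P f -> P (f + w).
  by move=> wvs; apply: Pv; rewrite inE wvs orbT.
by rewrite !fdiffs_cons !IH //; apply: Pv; rewrite ?mem_head.
Qed.

(** * Shapes and their factors *)

(** The columns of the non-roots in row [i] are [i + 1, ..., last_nonroot i].
    The value is an integer since a shape may transiently have a negative
    part, and it may exceed the number of columns. *)
Definition last_nonroot (K l : nat) (d : 'rV[int]_l) (i : 'I_l) : int :=
  K%:Z - d 0 i + i%:Z.

(** The shift of [1 - L_j] for a root [(i, j)], and of [1 - R_ij] for a
    non-root. *)
Definition factor_shift (K l : nat) (d : 'rV[int]_l) (p : 'I_l * 'I_l) :
    'rV[int]_l :=
  if last_nonroot K d p.1 < (p.2)%:Z then - eps p.2 else eps p.1 - eps p.2.

Definition weight (l : nat) (f : nat -> nat) : 'rV[int]_l := \row_i (f i)%:Z.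

Lemma eps_if l (z i : 'I_l) : eps z 0 i = if i == z :> nat then 1 else 0.
Proof. by rewrite mxE eqxx /= -val_eqE; case: ifP. Qed.

Lemma row_addE l (a b : 'rV[int]_l) i : (a + b) 0 i = a 0 i + b 0 i.
Proof. by rewrite mxE. Qed.

Lemma row_oppE l (a : 'rV[int]_l) i : (- a) 0 i = - a 0 i.
Proof. by rewrite mxE. Qed.

Definition weightE := (row_addE, row_oppE, eps_if).

Ltac rowlia := rewrite ?weightE; repeat (case: ifP => ?); lia.

Lemma last_nonroot_sub K l (d : 'rV[int]_l) (z i : 'I_l) :
  last_nonroot K (d - eps z) i = last_nonroot K d i + (i == z)%:R.
Proof. by rewrite /last_nonroot !mxE eqxx; case: (i == z) => /=; lia. Qed.

Lemma last_nonroot_add K l (d : 'rV[int]_l) (z i : 'I_l) :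
  last_nonroot K (d + eps z) i = last_nonroot K d i - (i == z)%:R.
Proof. by rewrite /last_nonroot !mxE eqxx; case: (i == z) => /=; lia. Qed.

Lemma sum_factor_shift K l (w : 'I_l -> int) (mu : 'rV[int]_l) p :
  \sum_i w i * factor_shift K mu p 0 i =
  (if last_nonroot K mu p.1 < p.2%:Z then 0 else w p.1) - w p.2.
Proof.
have epsE j : \sum_i w i * eps j 0 i = w j.
  rewrite (bigD1 j) //= eps_if eqxx mulr1 big1 ?addr0 // => i nij.
  by rewrite eps_if; move: nij; rewrite -val_eqE /= => /negbTE ->; rewrite mulr0.
rewrite /factor_shift; case: ifP => _.
  by under eq_bigr do rewrite row_oppE mulrN; rewrite sumrN epsE sub0r.
under eq_bigr do rewrite row_addE row_oppE mulrBr.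
by rewrite sumrB !epsE.
Qed.

(** * Closed Katalan functions with independent shape and subscript *)

Section Katalan.
Variables (A : comNzRingType) (h : nat -> A).

Definition kfun_of (r : nat) (m : int) : A :=
  match m with
  | Posz d => \sum_(i < d.+1) h (d - i)%N *+ 'C((r + i).-1%N, i)
  | Negz _ => 0
  end.

Definition kvec_of (l : nat) (g : 'rV[int]_l) : A := \prod_(i < l) kfun_of i (g 0 i).

(** Separating the shape [d] from the subscript [g] allows [L_z] to act as
    [g - eps z] while the roots stay those of [d].  The sequence [h] is
    arbitrary, so that the complete symmetric functions can be specialised. *)
Definition closedK (K l : nat) (d g : 'rV[int]_l) : A :=
  fdiffs [seq factor_shift K d p | p <- enum (Delta_plus l)] (@kvec_of l) g.

Lemma kfun_of_sub r m : kfun_of r.+1 m - kfun_of r.+1 (m - 1) = kfun_of r m.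
Proof.
case: m => [[|d]|d].
- by rewrite (_ : 0%:Z - 1 = Negz 0) //= !big_ord1 subr0 !bin0.
- rewrite (_ : d.+1%:Z - 1 = d) /=; last by lia.
  rewrite big_ord_recl /= [in RHS]big_ord_recl /= !bin0.
  rewrite -addrA; congr (_ + _); rewrite -sumrB; apply: eq_bigr => i _.
  by rewrite /bump /= add1n subSS addnS /= binS mulrnDr addrK.
- by rewrite (_ : Negz d - 1 = Negz d.+1) /= ?subr0 //; lia.
Qed.

(** The exponents of the factors at [r] and [r + 1] differ by one, and a
    factor [1 - L_s] lowers the second one to the first by [kfun_of_sub]. *)
Lemma kvec_of_swap l (r s : 'I_l) g : s = r.+1 :> nat ->
  fdiff (- eps s) (@kvec_of l) (col_perm (tperm r s) g) = fdiff (- eps s) (@kvec_of l) g.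
Proof.
move=> rs; have nsr: r != s by apply/eqP => e; move: rs; rewrite e; lia.
suff E (f : 'rV[int]_l) : fdiff (- eps s) (@kvec_of l) f =
    kfun_of r (f 0 s) * (kfun_of r (f 0 r) * \prod_(i < l | (i != s) && (i != r)) kfun_of i (f 0 i)).
  rewrite !E !mxE tpermR tpermL mulrCA; congr (_ * (_ * _)).
  by apply: eq_bigr => i /andP[nis nir]; rewrite mxE tpermD // eq_sym.
rewrite /fdiff /kvec_of (bigD1 s) //= (bigD1 r) //= [in X in _ - X](bigD1 s) //=.
rewrite [in X in _ - X](bigD1 r) //= !mxE !eqxx (negbTE nsr) /= mulr0n subr0.
rewrite [X in _ - _ * (_ * X)](eq_bigr (fun i : 'I_l => kfun_of i (f 0 i))).
  by rewrite -mulrBl rs kfun_of_sub.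
by move=> i /andP[nis nir]; rewrite !mxE (negbTE nis) subr0.
Qed.

Lemma perm_enum_split (T : finType) (D : {set T}) (X : seq T) :
  uniq X -> {subset X <= D} ->
  perm_eq (enum D) (X ++ enum (D :\: [set x in X])).
Proof.
move=> uX sX; apply: uniq_perm; rewrite ?enum_uniq //.
  rewrite cat_uniq uX enum_uniq /= andbT; apply/hasPn => x.
  by rewrite mem_enum !inE => /andP[].
move=> x; rewrite mem_cat !mem_enum !inE.
by case: (boolP (x \in X)) => //= /sX ->.
Qed.

Lemma closedK_split K l (d g : 'rV[int]_l) (X : seq ('I_l * 'I_l)) :
  uniq X -> {subset X <= Delta_plus l} ->
  closedK K d g = fdiffs (map (factor_shift K d) X ++
    [seq factor_shift K d p | p <- enum (Delta_plus l :\: [set x in X])]) (@kvec_of l) g.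
Proof.
by move=> uX sX; apply: fdiffs_perm; rewrite -map_cat perm_map // perm_enum_split.
Qed.

Lemma fdiffs_tperm (l : nat) (r s : 'I_l) vs (F : 'rV[int]_l -> A) g :
  (forall f, F (col_perm (tperm r s) f) = F f) ->
  perm_eq (map (col_perm (tperm r s)) vs) vs ->
  fdiffs vs F (col_perm (tperm r s) g) = fdiffs vs F g.
Proof.
move=> symF symv; rewrite -[RHS](eq_fdiffs vs (symF : F \o _ =1 F)).
by rewrite (fdiffs_additive (col_perm (tperm r s))) /=; apply/esym/fdiffs_perm.
Qed.

(** The transposition of the adjacent indices [r] and [s] permutes the pairs
    outside [X] and respects the root condition: rows [r] and [s] have the same
    last non-root, and a row [i] separates the columns [r] and [s] only when
    its last non-root is [r]. *)
Lemma factor_shifts_tperm K l (d : 'rV[int]_l) (r s : 'I_l) (X : {set 'I_l * 'I_l}) :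
  s = r.+1 :> nat -> last_nonroot K d r = last_nonroot K d s -> (r, s) \in X ->
  (forall i : 'I_l, (i < r)%N -> ((i, r) \in X) = ((i, s) \in X)) ->
  (forall i : 'I_l, (i < r)%N -> last_nonroot K d i = r -> (i, r) \in X) ->
  (forall j : 'I_l, (s < j)%N -> ((r, j) \in X) = ((s, j) \in X)) ->
  perm_eq
    (map (col_perm (tperm r s))
      [seq factor_shift K d p | p <- enum (Delta_plus l :\: X)])
    [seq factor_shift K d p | p <- enum (Delta_plus l :\: X)].
Proof.
move=> rs ers rsX Xc Xr Xrow.
pose t (p : 'I_l * 'I_l) := (tperm r s p.1, tperm r s p.2).
have tK : involutive t by move=> [i j]; rewrite /t /= !tpermK.
have tT p : p \in Delta_plus l :\: X -> t p \in Delta_plus l :\: X.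
  case: p => i j; rewrite /t !inE /=.
  case: tpermP => [->|->|/eqP nir /eqP nis];
    case: tpermP => [->|->|/eqP njr /eqP njs] //=; try by rewrite ltnn andbF.
  - by rewrite rsX.
  - by case/andP => nX rj; rewrite -Xrow ?nX; move: njs; rewrite -(inj_eq val_inj) /=; lia.
  - by case/andP => _; lia.
  - by case/andP => nX rj; rewrite Xrow ?nX; lia.
  - case/andP => nX ir; rewrite -Xc //= nX; lia.
  - case/andP => nX ir; have ir': (i < r)%N.
      by move: nir; rewrite -(inj_eq val_inj) /=; lia.
    by rewrite Xc // nX.
have tS p : p \in Delta_plus l :\: X ->
    col_perm (tperm r s) (factor_shift K d p) = factor_shift K d (t p).
  move=> pT; have -> : factor_shift K d (t p) = if last_nonroot K d p.1 < p.2%:Z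
      then - eps (t p).2 else eps (t p).1 - eps (t p).2.
    congr (if _ then _ else _); move: pT; case: p => i j; rewrite !inE /=.
    have ext_t : last_nonroot K d (tperm r s i) = last_nonroot K d i by case: tpermP => [->|->|].
    rewrite ext_t; case: tpermP => [->|->|//] /andP[nX lij].
    - have := Xr i lij; rewrite (negbTE nX); lia.
    - have [eir|nir] := eqVneq i r; first by move: nX; rewrite eir rsX.
      have ir : (i < r)%N by move: nir; rewrite -(inj_eq val_inj) /=; lia.
      have := Xr i ir; rewrite Xc // (negbTE nX); lia.
  have epsE i : col_perm (tperm r s) (eps i) = eps (tperm r s i).
    by apply/rowP => j; rewrite !mxE (can2_eq (tpermK r s) (tpermK r s)).
  by rewrite /factor_shift; case: ifP => _; rewrite ?raddfB ?raddfN /= !epsE.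
rewrite -map_comp (eq_in_map _ (factor_shift K d \o t) _).1; last first.
  by move=> p; rewrite mem_enum => /tS.
rewrite map_comp perm_map //; apply: uniq_perm; rewrite ?enum_uniq //.
  by rewrite (map_inj_uniq (can_inj tK)) enum_uniq.
move=> p; rewrite mem_enum; apply/mapP/idP => [[q]|pT].
  by rewrite mem_enum => qT ->; apply: tT.
by exists (t p); rewrite ?tK // mem_enum; apply: tT.
Qed.

(** With [X] the product of the factors other than the one at [(z, c)], this is
    the operator identity
    [(1 - L_c) L_z = (1 - R_zc) L_z (1 - L_c) + L_c (1 - L_c)] applied to [X],
    valid since [R_zc L_z = L_c]. *)
Lemma closedK_lower K l (d g : 'rV[int]_l) (z c : 'I_l) :
  c%:Z = last_nonroot K d z + 1 -> (z < c)%N ->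
  closedK K d (g - eps z) = closedK K (d - eps z) (g - eps z)
    - closedK K (d - eps z) (g - eps z - eps c) + closedK K d (g - eps c).
Proof.
move=> cE zc.
have zcD : {subset [:: (z, c)] <= Delta_plus l} by move=> p; rewrite !inE => /eqP ->.
rewrite !(fun d g => @closedK_split K l d g [:: (z, c)] isT zcD) //= !fdiffs_cons /factor_shift /= last_nonroot_sub eqxx.
rewrite ifT ?ifF; [|lia|lia].
set T := map _ _; set T' := map _ _; have -> : T' = T.
  apply/eq_in_map => -[i j]; rewrite mem_enum !inE xpair_eqE /factor_shift last_nonroot_sub /=.
  move=> /andP[nzc _]; congr (if _ then _ else _).
  have [iz|_] := eqVneq i z; last by rewrite addr0.
  by move: nzc; rewrite iz eqxx /= -(inj_eq val_inj) /=; lia.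
rewrite (_ : g - eps z + (eps z - eps c) = g - eps c); last first.
  by apply/rowP=> i; rewrite !mxE; lia.
rewrite (_ : g - eps z - eps c + (eps z - eps c) = g - eps c - eps c); last first.
  by apply/rowP=> i; rewrite !mxE; lia.
ring.
Qed.

(** When no row separates the columns [r] and [s], applying [1 - L_s] leaves
    [1 - R_rs] times a function [Q] invariant under the exchange of [r] and
    [s].  The shift of [R_rs] exchanges the entries [a] and [a + 1] of the
    subscript, so the two values of [Q] agree. *)
Lemma closedK_straighten0 K l (d g : 'rV[int]_l) (r s : 'I_l) :
  s = r.+1 :> nat -> last_nonroot K d r = last_nonroot K d s -> s%:Z <= last_nonroot K d r ->
  g 0 s = g 0 r + 1 -> (forall i : 'I_l, (i < r)%N -> last_nonroot K d i <> r%:Z) ->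
  closedK K d g = closedK K d (g - eps s).
Proof.
move=> rs ers sle gs noext.
have rsD : {subset [:: (r, s)] <= Delta_plus l}.
  by move=> p; rewrite !inE => /eqP ->; rewrite /= rs.
pose T := [seq factor_shift K d p | p <- enum (Delta_plus l :\: [set x in [:: (r, s)]])].
pose Q := fdiffs T (fdiff (- eps s) (@kvec_of l)).
have Qsym f : Q (col_perm (tperm r s) f) = Q f.
  apply: fdiffs_tperm; first by move=> f'; apply: kvec_of_swap.
  apply: factor_shifts_tperm => //; rewrite ?inE //.
  - by move=> i ir; rewrite !inE !xpair_eqE -!val_eqE /=; lia.
  - by move=> i ir /(noext i ir).
  - by move=> j sj; rewrite !inE !xpair_eqE -!val_eqE /=; lia.
apply/eqP; rewrite -subr_eq0; apply/eqP.
rewrite !(fun d g => @closedK_split K l d g [:: (r, s)] isT rsD) // [map _ [:: _]]/= -/T.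
rewrite [LHS](_ : _ = fdiffs (- eps s :: factor_shift K d (r, s) :: T) (@kvec_of l) g) //.
rewrite fdiffs_swap.
rewrite (@fdiffs_perm _ _ _ (factor_shift K d (r, s) :: T ++ [:: - eps s])); last first.
  by rewrite perm_cons -cat1s perm_catC.
rewrite fdiffs_cons !fdiffs_cat -/Q /factor_shift /= ifF; last by lia.
rewrite -[Q (g + _)]Qsym [col_perm _ _](_ : _ = g) ?subrr //.
apply/rowP => i; rewrite !mxE !eqxx.
have nrs : (r == s) = false by rewrite -val_eqE /=; lia.
case: tpermP => [->|->|/eqP/negbTE nir /eqP/negbTE nis];
  by rewrite ?[s == r]eq_sym ?eqxx ?nrs ?nir ?nis /=; lia.
Qed.

(** Here a single row [u] separates the columns [r] and [s].  Its factor
    [1 - L_s] at [(u, s)] is the one that makes [Q] invariant under the exchange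
    of [r] and [s]; both sides are then signed sums of four values of [Q], of
    which two cancel on each side and the remaining ones agree up to the
    exchange. *)
Lemma closedK_straighten1 K l (d g : 'rV[int]_l) (u r s : 'I_l) :
  s = r.+1 :> nat -> last_nonroot K d r = last_nonroot K d s -> s%:Z <= last_nonroot K d r ->
  g 0 s = g 0 r + 1 -> (u < r)%N -> last_nonroot K d u = r%:Z ->
  (forall i : 'I_l, (i < r)%N -> last_nonroot K d i = r%:Z -> i = u) ->
  closedK K d g = closedK K (d + eps u) (g + eps u - eps s).
Proof.
move=> rs ers sle gs ur extu ext_inj.
pose X := [:: (u, r); (u, s); (r, s)].
have XD : {subset X <= Delta_plus l}.
  by move=> p; rewrite !inE => /or3P[] /eqP -> /=; lia.
have uX : uniq X by rewrite /= !inE !xpair_eqE -!val_eqE /=; lia.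
pose T := [seq factor_shift K d p | p <- enum (Delta_plus l :\: [set x in X])].
have eqT : T = [seq factor_shift K (d + eps u) p
               | p <- enum (Delta_plus l :\: [set x in X])].
  apply/eq_in_map => -[i j]; rewrite mem_enum !inE !xpair_eqE /factor_shift last_nonroot_add /=.
  move=> nX; congr (if _ then _ else _).
  have [iu|_] := eqVneq i u; last by rewrite subr0.
  by move: nX; rewrite iu eqxx -!val_eqE /=; lia.
pose Q := fdiffs T (fdiff (- eps s) (@kvec_of l)).
have Qsym f : Q (col_perm (tperm r s) f) = Q f.
  apply: fdiffs_tperm; first by move=> f'; apply: kvec_of_swap.
  apply: factor_shifts_tperm => //; rewrite ?inE ?eqxx ?orbT //.
  - by move=> i ir; rewrite !inE !xpair_eqE -!val_eqE /=; lia.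
  - by move=> i ir /(ext_inj i ir) ->; rewrite !inE eqxx.
  - by move=> j sj; rewrite !inE !xpair_eqE -!val_eqE /=; lia.
have swapQ f f' : f' = col_perm (tperm r s) f -> Q f' = Q f by move=> ->.
(* The factor [1 - L_s] at [(u, s)] is absorbed into [Q]. *)
have split v : fdiffs ([:: v; - eps s; eps r - eps s] ++ T) (@kvec_of l)
    =1 fdiffs [:: v; eps r - eps s] Q.
  move=> f; rewrite -fdiffs_cat /Q.
  rewrite (@fdiffs_perm _ _ _ ([:: v; eps r - eps s] ++ T ++ [:: - eps s])).
    exact: (fdiffs_cat ([:: v; eps r - eps s] ++ T) [:: - eps s] (@kvec_of l) f).
  by rewrite /= perm_cons -[X in perm_eq X]cat1s perm_catC.
rewrite !(fun d g => @closedK_split K l d g X uX XD) -eqT -/T /= /factor_shift /=.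
have nru : (r == u) = false by rewrite -val_eqE /=; lia.
have nrs : (r == s) = false by rewrite -val_eqE /=; lia.
have nus : (u == s) = false by rewrite -val_eqE /=; lia.
rewrite !last_nonroot_add eqxx nru subr0 extu.
have /negbTE -> : ~~ (r%:Z < r%:Z) by lia.
have /negbTE -> : ~~ (last_nonroot K d r < s%:Z) by lia.
have -> : r%:Z < s%:Z by lia.
have -> : r%:Z - 1 < r%:Z by lia.
have -> : r%:Z - 1 < s%:Z by lia.
rewrite !(split _ _) /= !fdiffs_cons /fdiffs /=.
have -> : Q (g + (eps r - eps s)) = Q g.
  apply: swapQ; apply/rowP => i; rewrite !mxE.
  case: tpermP => [->|->|/eqP/negbTE nir /eqP/negbTE nis];
    by rewrite ?[s == r]eq_sym ?eqxx ?nrs ?nir ?nis /=; lia.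
have -> : Q (g + (eps u - eps r) + (eps r - eps s)) = Q (g + eps u - eps s).
  by congr Q; apply/rowP => i; rewrite !mxE; lia.
have -> : Q (g + eps u - eps s + (eps r - eps s)) = Q (g + (eps u - eps r)).
  apply: swapQ; apply/rowP => i; rewrite !mxE.
  case: tpermP => [->|->|/eqP/negbTE nir /eqP/negbTE nis];
    by rewrite ?[s == r]eq_sym ?[s == u]eq_sym ?eqxx ?nrs ?nru ?nus ?nir ?nis /=; lia.
have -> : Q (g + eps u - eps s - eps r + (eps r - eps s))
    = Q (g + eps u - eps s - eps r).
  apply: swapQ; apply/rowP => i; rewrite !mxE.
  case: tpermP => [->|->|/eqP/negbTE nir /eqP/negbTE nis];
    by rewrite ?[s == r]eq_sym ?[s == u]eq_sym ?eqxx ?nrs ?nru ?nus ?nir ?nis /=; lia.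
ring.
Qed.

End Katalan.

(** * Negative last part and trailing zeros *)

Section Zeros.
Variables (A : comNzRingType) (h : nat -> A).

Lemma kvec_of_neg l (g : 'rV[int]_l) i : g 0 i < 0 -> kvec_of h g = 0.
Proof.
by move=> gi; rewrite /kvec_of (bigD1 i) //=; case: (g 0 i) gi => //= n _; rewrite mul0r.
Qed.

Lemma factor_shift_last K l (d : 'rV[int]_l) (p : 'I_l * 'I_l) (i : 'I_l) :
  p \in Delta_plus l -> i.+1 = l -> factor_shift K d p 0 i = - (p.2 == i)%:R.
Proof.
rewrite inE => lp il; have := ltn_ord p.2 => p2l.
have ni : (p.1 == i) = false by rewrite -val_eqE /=; lia.
have ni' : (i == p.1) = false by rewrite eq_sym.
by rewrite /factor_shift [p.2 == i]eq_sym; case: ifP => _; rewrite !mxE eqxx /= ?ni' ?sub0r.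
Qed.

(** No factor raises the last entry of the subscript. *)
Lemma closedK_last_neg K l (d g : 'rV[int]_l) (i : 'I_l) :
  i.+1 = l -> g 0 i < 0 -> closedK h K d g = 0.
Proof.
move=> il; rewrite /closedK; apply: (fdiffs_vanish (P := fun f : 'rV[int]_l => f 0 i < 0)).
  by move=> f /kvec_of_neg.
move=> v f /mapP[p]; rewrite mem_enum => pD -> fi.
by rewrite mxE factor_shift_last //; case: (p.2 == i); rewrite /=; lia.
Qed.

(** The factors in the last column lower the last entry, which is [0], and so
    only contribute their leading [1]; the others do not touch it. *)
Lemma closedK_trailing0 K l (f : nat -> nat) : h 0%N = 1 -> f l = 0%N ->
  closedK h K (weight l.+1 f) (weight l.+1 f)
    = closedK h K (weight l f) (weight l f).
Proof.
move=> h0 fl0; set d' := weight l.+1 f; set d := weight l f.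
pose a (p : 'I_l.+1 * 'I_l.+1) := p.2 == ord_max.
pose w (i : 'I_l) := widen_ord (leqnSn l) i.
pose res : 'rV[int]_l.+1 -> 'rV[int]_l := colsub w.
have resE g i : res g 0 i = g 0 (w i) by rewrite mxE.
have resd : res d' = d by apply/rowP => i; rewrite !mxE.
rewrite /closedK.
set rest := [seq factor_shift K d' p | p <- filter (predC a) (enum (Delta_plus l.+1))].
have restP v : v \in rest -> v 0 ord_max = 0.
  case/mapP => p; rewrite mem_filter mem_enum => /andP[/negbTE ap pD] ->.
  by rewrite factor_shift_last // -/(a p) ap oppr0.
rewrite (@fdiffs_perm _ _ _
  ([seq factor_shift K d' p | p <- filter a (enum (Delta_plus l.+1))] ++ rest)); last first.
  by rewrite -map_cat perm_map // perm_sym perm_filterC.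
rewrite fdiffs_cat (@fdiffs_drop _ _ (fun g : 'rV[int]_l.+1 => g 0 ord_max < 0)); first last.
- move=> v /mapP[p]; rewrite mem_filter mem_enum => /andP[ap pD] ->.
  by rewrite mxE factor_shift_last // -/(a p) ap mxE /= fl0.
- move=> v g /mapP[p]; rewrite mem_filter mem_enum => /andP[ap pD] -> g0.
  by rewrite mxE factor_shift_last // -/(a p) ap /=; lia.
- move=> g; apply: (fdiffs_vanish (P := fun f : 'rV[int]_l.+1 => f 0 ord_max < 0)).
    by move=> g' /kvec_of_neg.
  by move=> v g' /restP v0 g'0; rewrite mxE v0 addr0.
rewrite (@eq_fdiffs_in _ _ (fun g : 'rV[int]_l.+1 => g 0 ord_max = 0) _ _ (@kvec_of A h l \o res)).
- rewrite (fdiffs_additive res) /= -/(res d') resd; apply: fdiffs_perm.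
  rewrite -map_comp.
  pose ww (p : 'I_l * 'I_l) := (w p.1, w p.2).
  have wI : injective w by move=> i j /(congr1 val) /= /val_inj.
  have wwI : injective ww by move=> [i j] [i' j'] [] /val_inj -> /val_inj ->.
  rewrite (@perm_trans _ [seq (res \o factor_shift K d') p
     | p <- map ww (enum (Delta_plus l))]) //.
    apply: perm_map; apply: uniq_perm.
    - by apply: filter_uniq; apply: enum_uniq.
    - by rewrite map_inj_uniq // enum_uniq.
    move=> [i j]; rewrite mem_filter mem_enum !inE /a /=; apply/idP/mapP.
      move=> /andP[nj ij]; have jl : (j < l)%N.
        by have := ltn_ord j; move: nj; rewrite -val_eqE /=; lia.
      have il : (i < l)%N by apply: ltn_trans jl.
      exists (Ordinal il, Ordinal jl); first by rewrite mem_enum !inE.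
      by congr pair; apply: val_inj.
    move=> [[i' j']]; rewrite mem_enum !inE /= => ij' [-> ->] /=.
    by rewrite ij' andbT -val_eqE /=; have := ltn_ord j'; lia.
  rewrite -map_comp.
  rewrite (_ : map _ _ = [seq factor_shift K d p | p <- enum (Delta_plus l)]) //.
  apply/eq_in_map => [[i j] _] /=.
  rewrite /factor_shift /= (_ : last_nonroot K d' (w i) = last_nonroot K d i); last by rewrite /last_nonroot !mxE.
  by case: ifP => _; apply/rowP => i'; rewrite !mxE !(inj_eq wI).
- move=> g g0; rewrite /kvec_of big_ord_recr /= g0 /= big_ord1 bin0 h0 mulr1.
  by apply: eq_bigr => i _; rewrite resE.
- by move=> v g /restP v0 g0; rewrite mxE v0 addr0.
- by rewrite mxE /= fl0.
Qed.

End Zeros.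

(** * Bounce chains and the cancellation along them *)

Definition bounded_part (K l : nat) (m : 'rV[int]_l) : Prop :=
  (forall i, 0 <= m 0 i <= K%:Z) /\
  (forall i j : 'I_l, (i <= j)%N -> m 0 j <= m 0 i).

(** A strict descent at [z], where the entry after the last one counts as
    [0]. *)
Definition descent (l : nat) (m : 'rV[int]_l) (z : 'I_l) : Prop :=
  0 < m 0 z /\ forall j : 'I_l, (z < j)%N -> m 0 j < m 0 z.

Lemma bounded_part_sub_eps K l (m : 'rV[int]_l) z :
  bounded_part K m -> descent m z -> bounded_part K (m - eps z).
Proof.
move=> [mb mm] [mz0 mz]; split=> [i|i j ij].
  have := mb i; have [->|niz] := eqVneq i z; first by rewrite !weightE eqxx; lia.
  by move: niz; rewrite -val_eqE /= => niz; rowlia.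
have mij := mm i j ij; have [iz|niz] := eqVneq i z; last first.
  by move: niz; rewrite -val_eqE /= => niz; rowlia.
have [jz|njz] := eqVneq j z; first by rewrite iz jz.
have zj : (z < j)%N by move: njz ij; rewrite iz -val_eqE /=; lia.
by have := mz j zj; rewrite iz; rowlia.
Qed.

(** The columns reached from row [z] by moving to the column of the first root
    of the current row, as long as the rows met have a successor with an equal
    part. *)
Inductive bounce_chain (K l : nat) (kap : 'rV[int]_l) (z : 'I_l) : 'I_l -> Prop :=
| bounce_first (c : 'I_l) of c%:Z = last_nonroot K kap z + 1 : bounce_chain K kap z c
| bounce_next (v u c : 'I_l) of
    bounce_chain K kap z v & u = v.+1 :> nat & kap 0 u = kap 0 v &
    c%:Z = last_nonroot K kap v + 1 : bounce_chain K kap z c.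

Section Chain.
Variables (A : comNzRingType) (h : nat -> A) (K l : nat).
Variables (kap : 'rV[int]_l) (z : 'I_l).
Hypotheses (kapP : bounded_part K kap) (zP : descent kap z).

Lemma last_nonroot_ge : z%:Z <= last_nonroot K kap z.
Proof. by have := kapP.1 z; rewrite /last_nonroot; lia. Qed.

Lemma last_nonroot_mono (i j : 'I_l) : (i < j)%N -> last_nonroot K kap i < last_nonroot K kap j.
Proof. by move=> ij; have := kapP.2 i j (ltnW ij); rewrite /last_nonroot; lia. Qed.

Lemma bounce_chain_ge c : bounce_chain K kap z c -> last_nonroot K kap z + 1 <= c%:Z.
Proof.
elim=> {c} [c -> //|v u c _ IH _ _ ->].
have zv : (z < v)%N by have := last_nonroot_ge; lia.
by have := last_nonroot_mono zv; lia.
Qed.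

Lemma bounce_chain_gt c : bounce_chain K kap z c -> (z < c)%N.
Proof. by move=> /bounce_chain_ge; have := last_nonroot_ge; lia. Qed.

(** Straightening at the columns [c], [s] goes up the chain: row [u = v + 1]
    is the only one that separates them, and after [closedK_straighten1] the
    rows [v] and [u] are in the position where [c] and [s] were.  At the top of
    the chain, row [z] separates the two columns for the shape [d - eps z] but
    not for [d], and the two straightening rules give the same value. *)
Lemma closedK_bounce c : bounce_chain K kap z c -> forall (s : 'I_l) (d g : 'rV[int]_l),
  s = c.+1 :> nat ->
  (forall i : 'I_l, (i < c)%N -> d 0 i = kap 0 i) ->
  (forall i : 'I_l, (z < i < c)%N -> g 0 i = kap 0 i) ->
  d 0 c < K%:Z -> d 0 s = d 0 c + 1 -> g 0 s = g 0 c + 1 ->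
  closedK h K d g = closedK h K (d - eps z) (g - eps z).
Proof.
elim=> {c} [c cE|v u c vC IH uv kuv cE] s d g sc dE gE dcK ds gs.
  have zc : (z < c)%N by have := last_nonroot_ge; lia.
  have extd (i : 'I_l) : (i < c)%N -> last_nonroot K d i = last_nonroot K kap i.
    by move=> ic; rewrite /last_nonroot dE.
  have noext (i : 'I_l) : (i < c)%N -> last_nonroot K d i <> c%:Z.
    move=> ic; rewrite extd // cE.
    have [iz|zi|iz] := ltngtP i z.
    - by have := last_nonroot_mono iz; lia.
    - have := zP.2 i zi; rewrite /last_nonroot; lia.
    - by rewrite (val_inj iz); lia.
  have exts : last_nonroot K d c = last_nonroot K d s by rewrite /last_nonroot; lia.
  have sle : s%:Z <= last_nonroot K d c by rewrite /last_nonroot; lia.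
  rewrite (closedK_straighten0 h sc exts sle gs noext).
  rewrite [RHS](@closedK_straighten1 _ h K l _ _ z c s) //.
  - by congr closedK; apply/rowP => i; rowlia.
  - by rewrite /last_nonroot; rowlia.
  - by rewrite /last_nonroot; rowlia.
  - by rowlia.
  - by rewrite last_nonroot_sub extd // eqxx /=; lia.
  - move=> i ic; rewrite last_nonroot_sub; have := noext i ic.
    by case: eqVneq => //= _; lia.
have zv := bounce_chain_gt vC; have zv' := bounce_chain_ge vC.
have kvK : kap 0 v < K%:Z by have := zP.2 v zv; have := kapP.1 z; lia.
have uc : (u < c)%N by move: cE; rewrite /last_nonroot; lia.
have extu : last_nonroot K kap u = c%:Z by move: cE; rewrite /last_nonroot kuv; lia.
have extd (i : 'I_l) : (i < c)%N -> last_nonroot K d i = last_nonroot K kap i.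
  by move=> ic; rewrite /last_nonroot dE.
have exts : last_nonroot K d c = last_nonroot K d s by rewrite /last_nonroot; lia.
have sle : s%:Z <= last_nonroot K d c by rewrite /last_nonroot; lia.
have ext_inj (i : 'I_l) : (i < c)%N -> last_nonroot K kap i = c%:Z -> i = u.
  move=> ic ei; have [iu|ui|/val_inj //] := ltngtP i u.
  - by have := last_nonroot_mono iu; lia.
  - by have := last_nonroot_mono ui; lia.
have nuz : (u == z) = false by rewrite -val_eqE /=; lia.
rewrite (@closedK_straighten1 _ h K l d g u c s) //; first last.
- by move=> i ic; rewrite extd //; apply: ext_inj.
- by rewrite extd.
rewrite [RHS](@closedK_straighten1 _ h K l _ _ u c s) //; first last.
- move=> i ic; rewrite last_nonroot_sub extd //; case: eqVneq => [->|_] /=; first lia.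
  by rewrite addr0; apply: ext_inj.
- by rewrite last_nonroot_sub extd // nuz /= addr0.
- by rowlia.
- by rewrite /last_nonroot; rowlia.
- by rewrite /last_nonroot; rowlia.
rewrite (IH u) ?uv //.
- by congr closedK; apply/rowP => i; rowlia.
- by move=> i iv; rewrite !weightE dE; [rowlia|lia].
- by move=> i iv; rewrite !weightE gE; [rowlia|lia].
- by rewrite !weightE dE; [rowlia|lia].
- by rewrite !weightE !dE; [rowlia|lia|lia].
- by rewrite !weightE !gE; [rowlia|lia|lia].
Qed.

End Chain.

(** * Lowering a part at a strict descent *)

Definition weight_sign (A : pzRingType) (l : nat) (m : 'rV[int]_l) : A :=
  (-1) ^+ absz (\sum_i m 0 i).

Lemma weight_sign_sub_eps (A : pzRingType) l (m : 'rV[int]_l) z :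
  weight_sign A (m - eps z) = - weight_sign A m.
Proof.
rewrite /weight_sign (_ : \sum_i (m - eps z) 0 i = \sum_i m 0 i - 1).
  rewrite -signr_odd -[in RHS]signr_odd.
  set x := \sum_i _; have -> : odd `|x - 1|%N = ~~ odd `|x|%N by lia.
  by case: odd; rewrite ?opprK.
under eq_bigr do rewrite row_addE row_oppE.
rewrite sumrB; congr (_ - _); rewrite (bigD1 z) //= big1 ?addr0.
  by rewrite eps_if eqxx.
by move=> i niz; rewrite eps_if; move: niz; rewrite -val_eqE /= => /negbTE ->.
Qed.

Section Lowering.
Variables (K l : nat).
Implicit Types (kap rho m : 'rV[int]_l) (z c : 'I_l).

Definition symfun_family := forall n, {mpoly rat[n]}.

(** An element of [S] stands for a term with coefficient [1] once both sides
    carry the sign of their degree, so the list is uniform in the number of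
    variables and its multiplicities are the absolute values of the
    coefficients.  The vector [rho] records the rows that are lowered in the
    subscript but not yet in the shape. *)
Definition sign_expands (P : 'rV[int]_l -> Prop) rho (x : symfun_family) : Prop :=
  exists2 S : seq 'rV[int]_l, forall m, m \in S -> P m &
    forall n, x n = \sum_(m <- S) weight_sign _ m * closedK (hsym n) K m (m - rho).

Lemma sign_expands0 P rho (x : symfun_family) : (forall n, x n = 0) -> sign_expands P rho x.
Proof. by move=> x0; exists [::] => // n; rewrite big_nil. Qed.

Lemma sign_expands_add P rho (x y z : symfun_family) : (forall n, z n = x n + y n) ->
  sign_expands P rho x -> sign_expands P rho y -> sign_expands P rho z.
Proof.
move=> zE [S SP xE] [T TP yE]; exists (S ++ T).
  by move=> m; rewrite mem_cat => /orP[/SP|/TP].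
by move=> n; rewrite zE xE yE big_cat.
Qed.

Lemma sign_expands_one (P : 'rV[int]_l -> Prop) rho m : P m ->
  sign_expands P rho (fun n => weight_sign _ m * closedK (hsym n) K m (m - rho)).
Proof.
by move=> Pm; exists [:: m] => [m'|n]; rewrite ?big_seq1 // inE => /eqP ->.
Qed.

Lemma sign_expands_sub (P Q : 'rV[int]_l -> Prop) rho (x y : symfun_family) :
  (forall m, P m -> Q m) -> (forall n, x n = y n) ->
  sign_expands P rho x -> sign_expands Q rho y.
Proof.
move=> PQ xy [S SP xE]; exists S; first by move=> m /SP /PQ.
by move=> n; rewrite -xy.
Qed.

Definition lowered z kap m : Prop :=
  [/\ bounded_part K m, forall i, m 0 i <= kap 0 i &
      forall i : 'I_l, (i < z)%N -> m 0 i = kap 0 i].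

(** The only pair whose status changes lies outside the columns. *)
Lemma closedK_nonroot_out (A : comNzRingType) (h : nat -> A) d g z :
  l%:Z <= last_nonroot K d z + 1 -> closedK h K d g = closedK h K (d - eps z) g.
Proof.
move=> lz; rewrite /closedK (_ : map _ _ =
  [seq factor_shift K (d - eps z) p | p <- enum (Delta_plus l)]) //.
apply/eq_in_map => -[i j] _; rewrite /factor_shift last_nonroot_sub /=.
have [->|_] := eqVneq i z; last by rewrite addr0.
by have := ltn_ord j => jl; congr (if _ then _ else _); lia.
Qed.

(** The contribution of the two [L_c]-terms of [closedK_lower].  If [kap] has a
    descent at [c], each term is expanded on its own.  Otherwise lowering row
    [c] in both terms leaves, after the cancellation of [closedK_bounce], the
    same expression at the next column of the chain, or zero if the chain
    leaves the columns. *)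
Lemma sign_expands_chain kap rho z c :
  bounded_part K kap -> descent kap z -> (forall i : 'I_l, (z <= i)%N -> rho 0 i = 0) ->
  (forall c' kap', (z < c')%N -> bounded_part K kap' -> descent kap' c' ->
    sign_expands (lowered c' kap') rho
      (fun n => - weight_sign _ kap' * closedK (hsym n) K kap' (kap' - rho - eps c'))) ->
  bounce_chain K kap z c ->
  sign_expands (lowered z kap) rho (fun n =>
    weight_sign _ kap * (closedK (hsym n) K (kap - eps z) (kap - rho - eps z - eps c)
                   - closedK (hsym n) K kap (kap - rho - eps c))).
Proof.
move=> kapP zP rho0 IHz; have [N] := ubnP (l - c)%N.
elim: N c => // N IH c lcN cC.
have zc := bounce_chain_gt kapP cC.
have descent_case : descent kap c -> sign_expands (lowered z kap) rho (fun n =>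
    weight_sign _ kap * (closedK (hsym n) K (kap - eps z) (kap - rho - eps z - eps c)
                   - closedK (hsym n) K kap (kap - rho - eps c))).
  move=> cD; have cD' : descent (kap - eps z) c.
    by case: cD => c0 cj; split=> [|j /[dup] /cj]; rowlia.
  have kap'P := bounded_part_sub_eps kapP zP.
  apply: (sign_expands_add _ (sign_expands_sub _ (fun=> erefl) (IHz c kap zc kapP cD))
    (sign_expands_sub _ (fun=> erefl) (IHz c _ zc kap'P cD'))) => [n|m|m].
  - rewrite weight_sign_sub_eps (_ : kap - eps z - rho - eps c = kap - rho - eps z - eps c).
      by ring.
    by apply/rowP => i; rowlia.
  - by case=> mP mle meq; split=> // i iz; apply: meq; lia.
  - case=> mP mle meq; split=> // i.
      by have := mle i; rowlia.
    by move=> iz; rewrite meq; [rowlia|lia].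
have [scl|lsc] := ltnP c.+1 l; last first.
  have cl : c.+1 = l by have := ltn_ord c; lia.
  have [c0|c0] := ltP 0 (kap 0 c).
    by apply: descent_case; split=> // j; have := ltn_ord j; lia.
  apply: sign_expands0 => n; rewrite !(closedK_last_neg _ _ _ cl) ?subr0 ?mulr0 //.
    by rewrite !weightE rho0; [rowlia|lia].
  by rewrite !weightE rho0; [rowlia|lia].
pose s := Ordinal scl.
have [ltsc|lecs] := ltP (kap 0 s) (kap 0 c).
  apply: descent_case; split=> [|j cj]; first by have := kapP.1 s; lia.
  by have := kapP.2 s j cj; lia.
have sc : kap 0 s = kap 0 c by have := kapP.2 c s (leqnSn c); lia.
have kcK : kap 0 c < K%:Z by have := zP.2 c zc; have := kapP.1 z; lia.
(* The terms created by lowering row [c] agree for the two shapes. *)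
have mirror n (g : 'rV[int]_l) : (forall i : 'I_l, (z < i < c)%N -> g 0 i = kap 0 i) ->
    g 0 s = g 0 c + 1 ->
    closedK (hsym n) K (kap - eps c) g = closedK (hsym n) K (kap - eps z - eps c) (g - eps z).
  move=> gE gs; rewrite (_ : kap - eps z - eps c = kap - eps c - eps z); last first.
    by apply/rowP => i; rowlia.
  apply: (closedK_bounce _ kapP zP cC (s := s)) => //.
  - by move=> i ic; rowlia.
  - by rowlia.
  - by rewrite !weightE /= sc; rowlia.
have last_nonroot' : last_nonroot K (kap - eps z) c = last_nonroot K kap c.
  by rewrite last_nonroot_sub -val_eqE /= gtn_eqF //= addr0.
have [bl|lb] := ltP (last_nonroot K kap c + 1) l%:Z; last first.
  apply: sign_expands0 => n; rewrite (closedK_nonroot_out _ _ lb).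
  rewrite (@closedK_nonroot_out _ _ (kap - eps z) _ c) ?last_nonroot' // mirror.
  - rewrite (_ : kap - rho - eps z - eps c = kap - rho - eps c - eps z) ?subrr ?mulr0 //.
    by apply/rowP => i; rowlia.
  - by move=> i ic; rewrite !weightE rho0; [rowlia|lia].
  - by rewrite !weightE !rho0 /= ?sc; [rowlia|lia|lia].
have cb : c.+1%:Z < last_nonroot K kap c + 1 by rewrite /last_nonroot; lia.
have [b bE] : exists b : 'I_l, b%:Z = last_nonroot K kap c + 1.
  have bl' : (absz (last_nonroot K kap c + 1)%R < l)%N by lia.
  by exists (Ordinal bl') => /=; lia.
have bC : bounce_chain K kap z b by apply: (bounce_next cC (u := s)).
apply: (sign_expands_sub (fun m H => H) _ (IH b _ bC)) => [n|]; last by lia.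
have zb : (c < b)%N by lia.
rewrite (_ : kap - rho - eps z - eps c = kap - eps z - rho - eps c); last first.
  by apply/rowP => i; rowlia.
rewrite (closedK_lower _ (kap - rho) bE zb).
rewrite (closedK_lower _ (kap - eps z - rho) (_ : b%:Z = last_nonroot K (kap - eps z) c + 1)) ?last_nonroot' //.
rewrite (mirror _ (kap - rho - eps c)).
- rewrite (mirror _ (kap - rho - eps c - eps b)).
  + rewrite (_ : kap - rho - eps z - eps b = kap - eps z - rho - eps b); last first.
      by apply/rowP => i; rowlia.
    rewrite (_ : kap - rho - eps c - eps z = kap - eps z - rho - eps c); last first.
      by apply/rowP => i; rowlia.
    rewrite (_ : kap - rho - eps c - eps b - eps z = kap - eps z - rho - eps c - eps b).
      by ring.
    by apply/rowP => i; rowlia.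
  + by move=> i ic; rewrite !weightE rho0; [rowlia|lia].
  + by rewrite !weightE !rho0 /= ?sc; [rowlia|lia|lia].
- by move=> i ic; rewrite !weightE rho0; [rowlia|lia].
- by rewrite !weightE !rho0 /= ?sc; [rowlia|lia|lia].
Qed.

Lemma sign_expands_lower z kap rho :
  bounded_part K kap -> descent kap z -> (forall i : 'I_l, (z <= i)%N -> rho 0 i = 0) ->
  sign_expands (lowered z kap) rho
    (fun n => - weight_sign _ kap * closedK (hsym n) K kap (kap - rho - eps z)).
Proof.
have [N] := ubnP (l - z)%N; elim: N z kap => // N IH z kap lzN kapP zP rho0.
have kap'P := bounded_part_sub_eps kapP zP.
have kap'L : lowered z kap (kap - eps z).
  by split=> // i; rowlia.
have kap'E : kap - eps z - rho = kap - rho - eps z by apply/rowP => i; rowlia.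
have [bl|lb] := ltP (last_nonroot K kap z + 1) l%:Z; last first.
  apply: (sign_expands_sub (fun m H => H) _ (sign_expands_one rho kap'L)) => n.
  by rewrite weight_sign_sub_eps kap'E -closedK_nonroot_out.
have zb : z%:Z < last_nonroot K kap z + 1 by have := last_nonroot_ge z kapP; lia.
have [b bE] : exists b : 'I_l, b%:Z = last_nonroot K kap z + 1.
  have bl' : (absz (last_nonroot K kap z + 1)%R < l)%N by lia.
  by exists (Ordinal bl') => /=; lia.
have zb' : (z < b)%N by lia.
have bC : bounce_chain K kap z b by apply: bounce_first.
apply: (sign_expands_add _ (sign_expands_one rho kap'L) (sign_expands_chain kapP zP rho0 _ bC)).
  by move=> n; rewrite (closedK_lower _ (kap - rho) bE zb') weight_sign_sub_eps kap'E; ring.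
move=> c' k' zc' k'P c'P; apply: IH => //; first by have := ltn_ord c'; lia.
by move=> i ci; apply: rho0; lia.
Qed.

End Lowering.

(** * Lowering all parts of a strict partition *)

Section Strict.
Variables (K l : nat).

Lemma sign_expands_bind (P Q : 'rV[int]_l -> Prop) rho rho' (x : symfun_family) :
  sign_expands K P rho x ->
  (forall m, P m -> sign_expands K Q rho'
     (fun n => - weight_sign _ m * closedK (hsym n) K m (m - rho))) ->
  sign_expands K Q rho' (fun n => - x n).
Proof.
move=> [S SP xE] PQ; apply: (sign_expands_sub (x := fun n =>
    \sum_(m <- S) - weight_sign _ m * closedK (hsym n) K m (m - rho)) (fun m Qm => Qm)).
  by move=> n; rewrite xE -sumrN; apply: eq_bigr => m _; rewrite mulNr.
elim: S SP {x xE} => [|m S IH] SP; first by apply: sign_expands0 => n; rewrite big_nil.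
apply: (sign_expands_add _ (PQ m (SP m (mem_head _ _))) (IH _)) => [n|m' m'S].
  by rewrite big_cons.
by apply: SP; rewrite inE m'S orbT.
Qed.

(** The rows are lowered from the last to the first.  When row [z] is reached,
    the shapes [m] in the expansion satisfy [m_z = f z + 1 > f j + 1 >= m_j]
    for [j > z], which is the descent needed by [sign_expands_lower]. *)
Lemma sign_expands_strict (f : nat -> nat) :
  (forall i, (i < l)%N -> (f i < K)%N) ->
  (forall i j, (i < j < l)%N -> (f j < f i)%N) ->
  sign_expands K (@bounded_part K l) 0 (fun n => weight_sign _ (weight l f) *
    closedK (hsym n) K (weight l (fun i => (f i).+1)) (weight l f)).
Proof.
move=> fK fdec; set lam := weight l f; set lam1 := weight l _.
have lam1E i : lam1 0 i = lam 0 i + 1 by rewrite !mxE -addn1.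
(* The rows above [z], lowered in the subscript but not in the shape. *)
pose prefix z : 'rV[int]_l := \row_i ((i < z)%N)%:R.
pose P z (m : 'rV[int]_l) := [/\ bounded_part K m, forall i, m 0 i <= lam1 0 i &
  forall i : 'I_l, (i < z)%N -> m 0 i = lam1 0 i].
have step t : (t <= l)%N -> sign_expands K (P (l - t)%N) (prefix (l - t)%N) (fun n =>
    (-1) ^+ (l - t) * (weight_sign _ lam * closedK (hsym n) K lam1 lam)).
  elim: t => [_|t IH tl].
    rewrite subn0; have Plam1 : P l lam1.
      split=> //; split=> [i|i j ij]; rewrite !mxE.
        by have := fK i (ltn_ord i); lia.
      have [->|nij] := eqVneq i j; first by [].
      have := fdec i j; rewrite ltn_ord andbT; move: nij; rewrite -val_eqE /=.
      by lia.
    apply: (sign_expands_sub (fun m Pm => Pm) _ (sign_expands_one K (prefix l) Plam1)) => n.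
    rewrite mulrA (_ : lam1 - prefix l = lam); last first.
      by apply/rowP => i; rewrite !weightE lam1E [prefix l 0 i]mxE ltn_ord addrK.
    congr (_ * _); rewrite /weight_sign (_ : \sum_i lam1 0 i = l%:Z + \sum_i lam 0 i).
      have : 0 <= \sum_i lam 0 i by apply: sumr_ge0 => i _; rewrite mxE.
      by case: (\sum_i _) => // q _; rewrite exprD.
    under eq_bigr do rewrite lam1E; rewrite big_split /= addrC; congr (_ + _).
    by rewrite sumr_const card_ord natz.
  have zl : (l - t.+1 < l)%N by lia.
  pose z := Ordinal zl; have zE : (l - t = z.+1)%N by rewrite /=; lia.
  rewrite zE in IH; have := sign_expands_bind (IH (ltnW tl)).
  move=> /(_ (P z) (prefix z)) IHz.
  apply: (sign_expands_sub (fun m Pm => Pm) _ (IHz _)) => [n|m [mP mle meq]].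
    by rewrite exprS mulN1r mulNr opprK.
  have zD : descent m z.
    split=> [|j zj]; first by rewrite meq // lam1E mxE; lia.
    rewrite (meq z) //; apply: le_lt_trans (mle j) _; rewrite !lam1E !mxE.
    by have := fdec z j; rewrite zj ltn_ord; lia.
  have prefix0 (i : 'I_l) : (z <= i)%N -> prefix z 0 i = 0.
    by move=> zi; rewrite mxE ltnNge zi.
  apply: (sign_expands_sub _ _ (sign_expands_lower mP zD prefix0)) => [m' [m'P m'le m'eq]|n].
    split=> // i; first exact: le_trans (m'le i) (mle i).
    by move=> iz; rewrite m'eq // meq //; lia.
  congr (_ * closedK _ _ _ _); apply/rowP => i; rewrite !weightE.
  rewrite [prefix z 0 i]mxE [prefix z.+1 0 i]mxE.
  by case: (ltnP i z) => ?; case: (ltnP i z.+1) => ? /=; case: ifP => ?; lia.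
have prefix0 : prefix 0%N = 0 by apply/rowP => i; rewrite !mxE.
have := step l (leqnn l); rewrite subnn prefix0 => step0.
apply: (sign_expands_sub _ _ step0) => [m []//|n].
by rewrite expr0 mul1r.
Qed.

End Strict.

(** * Expansion of the closed k-Schur Katalan functions *)

(** The multiset of second components of the roots matches the roots one by
    one.  The root condition depends on [k - s_i] only, whence the freedom to
    raise the level and all parts by [e]. *)
Lemma closed_kschur_closedK n k e (s : seq nat) : all (fun p => p <= k)%N s ->
  closed_kschur n k s = closedK (hsym n) (k + e)
    (weight (size s) (fun i => nth 0 s i + e)%N)
    (weight (size s) (nth 0%N s)).
Proof.
move=> /allP sk; rewrite /closed_kschur /Katalan /closedK.
set D := Delta_k k s; set d := weight _ _; set g := \row_i _.
have eqR (vs : seq ('I_(size s) * 'I_(size s))) :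
    foldr (@one_sub_R _ _) (@kvec n _) vs
    =1 fdiffs [seq eps p.1 - eps p.2 | p <- vs] (@kvec_of _ (hsym n) (size s)).
  by elim: vs => // p vs IH f; rewrite /= fdiffs_cons /one_sub_R !IH addrA.
have eqL (F F' : 'rV[int]_(size s) -> {mpoly rat[n]}) zs : F =1 F' ->
    foldr (@one_sub_L _ _) F zs =1 fdiffs [seq - eps z | z <- zs] F'.
  by move=> eqF; elim: zs => // z zs IH f; rewrite /= fdiffs_cons /one_sub_L !IH.
rewrite (eqL _ _ _ (eqR _)) -fdiffs_cat; apply: fdiffs_perm.
have rootE p : p \in Delta_plus (size s) ->
    (p \in D) = (last_nonroot (k + e) d p.1 < p.2%:Z).
  rewrite !inE => ->; rewrite /last_nonroot !mxE /=.
  have := sk _ (mem_nth 0%N (ltn_ord p.1)).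
  by move: (nth _ _ _) => x xk; apply/idP/idP; lia.
have sD : {subset enum D <= Delta_plus (size s)}.
  by move=> p; rewrite mem_enum !inE => /andP[].
have DE : [set p in enum D] = D by apply/setP => p; rewrite inE mem_enum.
have := perm_enum_split (enum_uniq _) sD; rewrite DE perm_sym => /(perm_map (factor_shift (k + e) d)).
apply: perm_trans; rewrite map_cat -map_comp.
rewrite (_ : map _ (enum D) = map (factor_shift (k + e) d) (enum D)); last first.
  apply/eq_in_map => p; rewrite mem_enum => pD; rewrite /factor_shift -rootE ?pD //.
  by apply: sD; rewrite mem_enum.
rewrite (_ : map _ (enum (_ :\: D)) = map (factor_shift (k + e) d) (enum (Delta_plus (size s) :\: D))) //.
apply/eq_in_map => p; rewrite mem_enum inE => /andP[nD pP].
by rewrite /factor_shift -rootE // (negbTE nD).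
Qed.

Lemma hsym0 n : hsym n 0 = 1.
Proof.
have m0P : (mdeg (0%MM : 'X_{1..n}) < 1)%N by rewrite mdeg0.
rewrite /hsym (bigD1 (BMultinom m0P)) /= ?mdeg0 // mpolyX0 big1 ?addr0 //.
by move=> m; rewrite mdeg_eq0 => /andP[/eqP m0 /eqP[]]; apply: val_inj.
Qed.

Lemma nth_filter_gt0 (t : seq nat) i :
  sorted geq t -> nth 0%N (filter (ltn 0) t) i = nth 0%N t i.
Proof.
elim: t i => //= x t IH i xt; case: ltnP => [x0|].
  by case: i => //= i; apply: IH; apply: path_sorted xt.
rewrite leqn0 => /eqP x0; move: xt; rewrite x0.
move=> /(order_path_min (rev_trans leq_trans)) t0.
have t0' y : y \in t -> y = 0%N by move/(allP t0); rewrite /= leqn0 => /eqP.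
have -> : filter (ltn 0) t = [::].
  by apply/eqP; rewrite -[_ == _]negbK -has_filter; apply/hasPn => y /t0' ->.
rewrite nth_nil; case: i => //= i; have [it|ti] := ltnP i (size t).
  by apply/esym/t0'/mem_nth.
by rewrite nth_default.
Qed.

Section Shape.
Variables (K l : nat).

Definition shape (m : 'rV[int]_l) : seq nat :=
  filter (ltn 0) [seq absz (m 0 i) | i <- enum 'I_l].

Lemma sumn_shape m : bounded_part K m -> (sumn (shape m))%:Z = \sum_i m 0 i.
Proof.
move=> [mb _]; have -> : sumn (shape m) = sumn [seq absz (m 0 i) | i <- enum 'I_l].
  by rewrite /shape; elim: map => //= x t IH; case: ltnP => /= [_|]; rewrite ?IH //; lia.
rewrite sumnE big_map big_enum /= -natz natr_sum; apply: eq_bigr => i _.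
by rewrite natz; have := mb i; lia.
Qed.

Lemma nth_parts (m : 'rV[int]_l) (i : 'I_l) :
  nth 0%N [seq absz (m 0 i) | i <- enum 'I_l] i = absz (m 0 i).
Proof. by rewrite (nth_map i) ?size_enum_ord // nth_ord_enum. Qed.

Lemma sorted_parts m : bounded_part K m -> sorted geq [seq absz (m 0 i) | i <- enum 'I_l].
Proof.
move=> [mb mm]; apply/(sortedP 0%N) => i; rewrite size_map size_enum_ord => il.
have il' : (i < l)%N by lia.
rewrite (nth_parts m (Ordinal il)) (nth_parts m (Ordinal il')) /=.
have := mm (Ordinal il') (Ordinal il) (leqnSn i).
by have := mb (Ordinal il'); have := mb (Ordinal il); lia.
Qed.

Lemma weight_shape m : bounded_part K m -> weight l (nth 0%N (shape m)) = m.
Proof.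
move=> mP; apply/rowP => i; rewrite mxE nth_filter_gt0 ?sorted_parts //.
by rewrite nth_parts; have := mP.1 i; lia.
Qed.

Lemma is_bpart_shape m : bounded_part K m -> is_bpart K (shape m).
Proof.
move=> mP; apply/andP; split; last first.
  by apply: sorted_filter (sorted_parts mP); apply: rev_trans leq_trans.
apply/allP => x; rewrite mem_filter => /andP[x0 /mapP[i _ xE]].
by move: x0; rewrite /= xE => ->; have := mP.1 i; lia.
Qed.

(** The zero parts dropped by [shape] are trailing ones, since [m] is a
    partition. *)
Lemma closed_kschur_shape n m : bounded_part K m ->
  closed_kschur n K (shape m) = closedK (hsym n) K m m.
Proof.
move=> mP; have /andP[/allP sK _] := is_bpart_shape mP.
rewrite (@closed_kschur_closedK _ _ 0); last by apply/allP => x /sK /andP[].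
rewrite addn0 (_ : weight _ (fun i => _) =
  weight (size (shape m)) (nth 0%N (shape m))); last first.
  by apply/rowP => i; rewrite !mxE addn0.
have sl : (size (shape m) <= l)%N.
  by rewrite size_filter (leq_trans (count_size _ _)) // size_map size_enum_ord.
rewrite -[in RHS](weight_shape mP) -(subnKC sl).
elim: (l - _)%N => [|e IH]; first by rewrite addn0.
by rewrite addnS closedK_trailing0 ?hsym0 // nth_default ?leq_addr.
Qed.

End Shape.

(** Collecting like terms in a finite linear combination. *)
Lemma fsfun_of_seq (X : eqType) (T : choiceType) (S : seq X) (b : X -> T)
    (c : X -> rat) :
  exists a : {fsfun T -> rat with 0},
    (forall mu, a mu = \sum_(m <- S | b m == mu) c m) /\
    forall (V : lmodType rat) (G : T -> V),
      \sum_(mu <- finsupp a) a mu *: G mu = \sum_(m <- S) c m *: G (b m).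
Proof.
pose E := [fset mu in map b S]%fset.
pose a : {fsfun T -> rat with 0} := [fsfun mu in E => \sum_(m <- S | b m == mu) c m].
have aE mu : a mu = \sum_(m <- S | b m == mu) c m.
  rewrite fsfunE; case: ifP => // /negP nE; rewrite big_seq_cond big1 //.
  by move=> m /andP[mS /eqP bm]; case: nE; rewrite !inE -bm map_f.
exists a; split=> // V G.
rewrite (big_fset_incl _ (finsupp_sub _ _ _) (B := E)) /=; last first.
  by move=> mu _; rewrite memNfinsupp => /eqP ->; rewrite scale0r.
under eq_bigr do rewrite aE scaler_suml.
rewrite (exchange_big_dep predT) //= big_seq [RHS]big_seq; apply: eq_bigr => m mS.
under eq_bigl do rewrite eq_sym.
rewrite -big_filter filter_pred1_uniq ?fset_uniq ?big_seq1 //.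
by rewrite !inE map_f.
Qed.

Lemma weight_sign_scale (n l : nat) (m : 'rV[int]_l) (x : {mpoly rat[n]}) :
  weight_sign _ m * x = weight_sign rat m *: x.
Proof.
by rewrite /weight_sign -signr_odd -[in RHS]signr_odd; case: odd;
  rewrite ?expr1 ?expr0 ?mulN1r ?scaleN1r ?mul1r ?scale1r.
Qed.

Lemma weight_signK (l : nat) (m : 'rV[int]_l) : weight_sign rat m * weight_sign rat m = 1.
Proof. by rewrite -expr2 sqrr_sign. Qed.

Lemma sign_exprz (x : int) : (-1) ^ x = (-1) ^+ absz x :> rat.
Proof. by case: (intP x) => // n; rewrite abszN /= -exprz_inv invrN1. Qed.

Lemma kschur_expansion_exists k l (lam : l.-tuple nat) : in_sP k lam ->
  exists2 a : {fsfun bpart k.+1 -> rat with 0},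
    kschur_expansion (fun n => closed_kschur n k lam) a &
    forall mu : bpart k.+1,
      (-1) ^ ((sumn lam)%:Z - (sumn (val mu))%:Z) * a mu \is a Num.nat.
Proof.
move=> /andP[/and3P[_ lamk lam_sorted] /forallP lam_strict].
have lamE i : (i < l)%N -> (nth 0 lam i <= k)%N.
  by move=> il; apply: (allP lamk); rewrite mem_nth ?size_tuple.
have lam_dec i j : (i < j < l)%N -> (nth 0 lam j < nth 0 lam i)%N.
  case/andP => ij jl; have il : (i.+1 < l)%N by lia.
  have /forallP/(_ (Ordinal il))/implyP := lam_strict (Ordinal (ltnW il)).
  rewrite !(tnth_nth 0%N) /= eqxx => /(_ isT); apply: leq_ltn_trans.
  have geq_trans : transitive geq by apply: rev_trans leq_trans.
  have := @sorted_leq_nth _ _ geq_trans leqnn 0%N _ lam_sorted i.+1 j.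
  by rewrite !inE size_tuple; apply.
have [S SP SE] := @sign_expands_strict k.+1 l (nth 0%N lam) lamE lam_dec.
pose mu0 : bpart k.+1 := exist _ [::] isT.
pose b (m : 'rV[int]_l) : bpart k.+1 := insubd mu0 (shape m).
have bE m : m \in S -> val (b m) = shape m.
  by move=> mS; rewrite insubdK //; apply: is_bpart_shape; apply: SP.
set lamw := weight l (nth 0%N lam).
have [a [aE asum]] := fsfun_of_seq S b (fun m => weight_sign _ lamw * weight_sign _ m).
exists a => [n|mu].
  rewrite asum (@closed_kschur_closedK _ _ 1); last exact: lamk.
  rewrite addn1 size_tuple -/lamw.
  rewrite (_ : weight l (fun i => _ + 1)%N
    = weight l (fun i => (nth 0%N lam i).+1)); last first.
    by apply/rowP => i; rewrite !mxE addn1.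
  apply: (@mulrI _ (weight_sign _ lamw)); first by rewrite unitrX // unitrN1.
  rewrite SE mulr_sumr [LHS]big_seq [RHS]big_seq; apply: eq_bigr => m mS.
  rewrite bE // (closed_kschur_shape _ (SP m mS)).
  rewrite (_ : m - 0 = m); last by apply/rowP => i; rewrite !mxE; lia.
  by rewrite !weight_sign_scale scalerA mulrA weight_signK mul1r.
rewrite aE mulr_sumr big_seq_cond; apply: rpred_sum => m /andP[mS /eqP <-].
rewrite bE // (sumn_shape (SP m mS)) sign_exprz /weight_sign.
have lamE' : \sum_i lamw 0 i = (sumn lam)%:Z.
  rewrite sumnE (big_nth 0%N) size_tuple big_mkord -natz natr_sum.
  by apply: eq_bigr => i _; rewrite mxE natz.
rewrite lamE' -exprD -exprD -signr_odd (_ : odd _ = false) //; last by lia.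
Qed.

(** * A strictly concave injective system of exponents *)

Lemma digits_inj B M (c c' : nat -> nat) :
  (forall d, c d < B)%N -> (forall d, c' d < B)%N ->
  (\sum_(d < M) c d * B ^ d = \sum_(d < M) c' d * B ^ d)%N ->
  forall d, (d < M)%N -> c d = c' d.
Proof.
elim: M c c' => // M IH c c' cB c'B.
have shiftE (a : nat -> nat) :
    (\sum_(d < M.+1) a d * B ^ d = (\sum_(d < M) a d.+1 * B ^ d) * B + a 0)%N.
  rewrite big_ord_recl expn0 muln1 addnC big_distrl /=; congr (_ + _)%N.
  by apply: eq_bigr => i _; rewrite /bump /= expnSr mulnA.
rewrite !shiftE => e; have B0 : (0 < B)%N by apply: leq_ltn_trans (cB 0%N).
have c0 : c 0%N = c' 0%N.
  by move/(congr1 (modn^~ B)): e; rewrite !modnMDl !modn_small.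
move=> [//|d]; rewrite ltnS; apply: (IH (fun d => c d.+1) (fun d => c' d.+1)) => //.
by move: e; rewrite c0 => /addIn /eqP; rewrite eqn_pmul2r // => /eqP.
Qed.

Section Degrees.
Variables (B K : nat).
Hypothesis B3 : (2 < B)%N.

Definition concave_exp (d : nat) : nat := (B ^ K - B ^ (K - d))%N.

Let B_gt0 a : (0 < B ^ a)%N. Proof. by rewrite expn_gt0; lia. Qed.

Lemma concave_expE d : (concave_exp d + B ^ (K - d) = B ^ K)%N.
Proof. by rewrite subnK // leq_pexp2l ?leq_subr //; lia. Qed.

Lemma leq_concave_exp i d : (i <= d)%N -> (concave_exp i <= concave_exp d)%N.
Proof. by move=> id; apply: leq_sub2l; apply: leq_pexp2l; lia. Qed.

Lemma ltn_concave_exp i d : (i < d <= K)%N -> (concave_exp i < concave_exp d)%N.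
Proof.
move=> id; have := concave_expE i; have := concave_expE d.
have : (B ^ (K - d) < B ^ (K - i))%N by rewrite ltn_exp2l; lia.
by lia.
Qed.

(** Since [sum_x concave_exp x = size s * B ^ K - sum_x B ^ (K - x)], the size is
    determined by the quotient by [B ^ K], and the digits in base [B] of the
    last sum are the multiplicities of the parts. *)
Lemma concave_exp_sum_inj (s t : seq nat) :
  is_bpart K s -> is_bpart K t -> (size s < B)%N -> (size t < B)%N ->
  (\sum_(x <- s) concave_exp x = \sum_(x <- t) concave_exp x)%N -> s = t.
Proof.
pose T u := (\sum_(x <- u) B ^ (K - x))%N.
pose c u d := count (fun x => (K - x)%N == d) u.
have sumE u : (\sum_(x <- u) concave_exp x + T u = size u * B ^ K)%N.
  rewrite /T -big_split /=; under eq_bigr do rewrite concave_expE.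
  by rewrite big_const_seq count_predT iter_addn_0 mulnC.
have TE u : all (fun p => 0 < p <= K)%N u -> T u = (\sum_(d < K) c u d * B ^ d)%N.
  rewrite /T; elim: u => [_|x u IH /= /andP[xK /IH uE]].
    by rewrite big_nil big1 // => d _; rewrite mul0n.
  have xK' : (K - x < K)%N by lia.
  rewrite big_cons {}uE (bigD1 (Ordinal xK')) //= [in RHS](bigD1 (Ordinal xK')) //=.
  rewrite /c /= eqxx mulnDl mul1n !addnA; congr (_ + _)%N.
  apply: eq_bigr => d; rewrite -val_eqE eq_sym /= => /negbTE ->.
  by rewrite add0n.
have T_lt u : all (fun p => 0 < p <= K)%N u -> (size u < B)%N -> (T u < B ^ K)%N.
  case: u => [|x u] uK ub; first by rewrite /T big_nil.
  have K0 : (0 < K)%N by move: uK => /andP[]; lia.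
  apply: (@leq_ltn_trans (size (x :: u) * B ^ K.-1)%N); last first.
    by rewrite -{2}(prednK K0) expnS ltn_mul2r B_gt0.
  rewrite /T; elim: (x :: u) uK => [|y v IH] /=; first by rewrite big_nil.
  move=> /andP[yK /IH vK]; rewrite big_cons mulSn leq_add //.
  by apply: leq_pexp2l; lia.
move=> /andP[sK s_sorted] /andP[tK t_sorted] sB tB est.
have sT := sumE s; have tT := sumE t.
have e : (size s * B ^ K + T t = size t * B ^ K + T s)%N by lia.
have eT : T s = T t.
  move/(congr1 (modn^~ (B ^ K)%N)): e.
  by rewrite !modnMDl !modn_small // T_lt.
have cE d : (d < K)%N -> c s d = c t d.
  apply: (@digits_inj B K) => [d'|d'|]; last by rewrite -!TE.
    by apply: leq_ltn_trans sB; apply: count_size.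
  by apply: leq_ltn_trans tB; apply: count_size.
have geq_trans : transitive geq by apply: rev_trans leq_trans.
have geq_anti : antisymmetric geq by move=> x y; rewrite andbC; apply: anti_leq.
apply: (sorted_eq geq_trans geq_anti) => //.
have cntE u x : all (fun p => 0 < p <= K)%N u -> (0 < x <= K)%N ->
    count_mem x u = c u (K - x)%N.
  move=> /allP uK xK; apply: eq_in_count => y /uK yK /=; lia.
apply/allP => x _ /=; have [xK|nxK] := boolP (0 < x <= K)%N.
  by rewrite !cntE // cE //; lia.
have cnt0 u : all (fun p => 0 < p <= K)%N u -> count_mem x u = 0%N.
  by move=> /allP uK; apply/count_memPn; apply/negP => /uK; rewrite (negbTE nxK).
by rewrite !cnt0.
Qed.

(** Strict convexity of [B ^ (K - x)], with [B ^ (K - m)] as the negative of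
    a slope at [m].  It also holds for [K < a], where the truncated difference
    makes the power equal to [1]. *)
Lemma concave_exp_tangent a m : (m <= K)%N -> a <> m ->
  (B ^ (K - m))%:Z * (m%:Z - a%:Z) < (B ^ (K - a))%:Z - (B ^ (K - m))%:Z.
Proof.
move=> mK am; set p := (B ^ (K - m))%N; have p0 : (0 < p)%N by apply: B_gt0.
have [am'|am'] : (a < m \/ m < a)%N by lia.
  have -> : (B ^ (K - a) = p * B ^ (m - a))%N.
    by rewrite -expnD; congr (_ ^ _)%N; lia.
  have pow t : (0 < t)%N -> (t.+1 < B ^ t)%N.
    elim: t => // -[|t] IH _; first by rewrite expn1.
    by rewrite expnS; have := IH isT; nia.
  have := pow (m - a)%N; rewrite subn_gt0 => /(_ am'); nia.
by have := B_gt0 (K - a); nia.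
Qed.

End Degrees.

(** * Leading terms under the specialisation to powers *)

Section Triangular.
Variables (B K l : nat).
Hypothesis B3 : (2 < B)%N.

Let e := concave_exp B K.
Let hX d : {poly rat} := 'X^(e d).

Lemma size_hX_mulrn d n : (size (hX d *+ n) <= (e d).+1)%N.
Proof. by rewrite -scaler_nat (leq_trans (size_scale_leq _ _)) // size_polyXn. Qed.

Lemma size_kfun_of_hX r d : (size (kfun_of hX r (Posz d)) <= (e d).+1)%N.
Proof.
apply: (leq_trans (size_sum _ _ _)); apply/bigmax_leqP => i _.
by apply: leq_trans (size_hX_mulrn _ _) _; rewrite ltnS leq_concave_exp // leq_subr.
Qed.

Lemma kfun_of_hX_monic r d : (d <= K)%N ->
  kfun_of hX r (Posz d) \is monic /\ size (kfun_of hX r (Posz d)) = (e d).+1.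
Proof.
move=> dK; rewrite /kfun_of big_ord_recl subn0 bin0 mulr1n; set q := \sum_(_ < _) _.
have sq : (size q < size (hX d))%N.
  rewrite size_polyXn ltnS; apply: leq_trans (size_sum _ _ _) _.
  apply/bigmax_leqP => i _; apply: leq_trans (size_hX_mulrn _ _) _.
  by apply: ltn_concave_exp => //; rewrite lift0; have := ltn_ord i; lia.
by rewrite monicE lead_coefDl // lead_coefXn size_polyDl // size_polyXn.
Qed.

Lemma size_kvec_of_hX (g : 'rV[int]_l) : (forall i, 0 <= g 0 i) ->
  (size (kvec_of hX g) <= (\sum_i e (absz (g 0%R i))).+1)%N.
Proof.
move=> g0; pose P (p : {poly rat}) n := (size p <= n.+1)%N.
rewrite -/(P _ _) /kvec_of; apply: (big_ind2 P); rewrite /P.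
- by rewrite size_poly1.
- move=> p n q m pn qm; apply: leq_trans (size_polyMleq _ _) _.
  by move: pn qm; lia.
- by move=> i _; have := g0 i; case: (g 0 i) => // d _; apply: size_kfun_of_hX.
Qed.

Lemma kvec_of_hX_monic (g : 'rV[int]_l) : (forall i, 0 <= g 0 i <= K%:Z) ->
  kvec_of hX g \is monic /\
  size (kvec_of hX g) = (\sum_i e (absz (g 0%R i))).+1.
Proof.
move=> g0; pose P (p : {poly rat}) n := p \is monic /\ size p = n.+1.
rewrite -/(P _ _) /kvec_of; apply: (big_ind2 P); rewrite /P.
- by rewrite size_poly1; split=> //; apply: monic1.
- move=> p n q m [pm ps] [qm qs]; split; first by rewrite monicMl.
  by rewrite size_monicM ?monic_neq0 // ps qs addSn addnS.
- move=> i _; have := g0 i; case: (g 0 i) => // d dK.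
  by apply: kfun_of_hX_monic; lia.
Qed.

(** An intersection of two half spaces that is stable under the shifts of a
    Katalan function of shape [mu] and contains every subscript met there
    except [mu] itself.  The coefficients of the first form are, up to sign,
    slopes of the convex function [B ^ (K - x)] at the parts of [mu]; the
    second form keeps [g] away from [mu]. *)
Definition dominated (mu g : 'rV[int]_l) : Prop :=
  \sum_i (B ^ (K - absz (mu 0%R i)))%:Z * (g 0 i - mu 0 i) <= 0 /\
  \sum_(i < l) i.+1%:Z * (g 0 i - mu 0 i) < 0.

(** Summing the tangent inequalities over the coordinates, the degree at [g]
    falls short of the degree at [mu] by a positive amount. *)
Lemma size_kvec_of_dominated mu g : bounded_part K mu -> dominated mu g ->
  (size (kvec_of hX g) <= \sum_i e (absz (mu 0%R i)))%N.
Proof.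
move=> [mub _] [th rho]; have [/forallP g0|] := boolP [forall i, 0 <= g 0 i]; last first.
  by case/forallPn => i; rewrite -ltNge => /kvec_of_neg ->; rewrite size_poly0.
apply: leq_trans (size_kvec_of_hX g0) _.
pose psi d := (B ^ (K - d))%N.
have eE (f : 'rV[int]_l) :
    (\sum_i e (absz (f 0%R i)) + \sum_i psi (absz (f 0%R i)) = l * B ^ K)%N.
  rewrite -big_split /=; under eq_bigr do rewrite concave_expE //.
  by rewrite sum_nat_const card_ord.
suff : (\sum_i psi (absz (mu 0%R i)) < \sum_i psi (absz (g 0%R i)))%N.
  by have := eE mu; have := eE g; lia.
have [/forallP eqg|/forallPn[i gi]] := boolP [forall i, g 0 i == mu 0 i].
  by move: rho; rewrite big1 // => i _; rewrite (eqP (eqg i)) subrr mulr0.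
have tangent j : (psi (absz (mu 0%R j)))%:Z * (mu 0 j - g 0 j) <=
    (psi (absz (g 0%R j)))%:Z - (psi (absz (mu 0%R j)))%:Z ?= iff (g 0 j == mu 0 j).
  have muj := mub j; have gj := g0 j; split.
    have [->|/eqP ngj] := eqVneq (g 0 j) (mu 0 j); first by rewrite !subrr mulr0.
    have := @concave_exp_tangent B K B3 (absz (g 0 j)) (absz (mu 0 j)).
    by rewrite /psi; have -> : mu 0 j - g 0 j =
      (absz (mu 0 j))%:Z - (absz (g 0 j))%:Z; lia.
  apply/eqP/eqP => [|->]; last by rewrite !subrr mulr0.
  move=> eqp; apply/eqP; apply: contra_eqT eqp => /eqP ngj.
  have := @concave_exp_tangent B K B3 (absz (g 0 j)) (absz (mu 0 j)).
  have -> : mu 0 j - g 0 j = (absz (mu 0 j))%:Z - (absz (g 0 j))%:Z by lia.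
  by move=> H; rewrite lt_eqF // H //; lia.
have : \sum_j (psi (absz (mu 0%R j)))%:Z * (mu 0 j - g 0 j) <
    \sum_j ((psi (absz (g 0%R j)))%:Z - (psi (absz (mu 0%R j)))%:Z).
  rewrite (bigD1 i) //= [X in _ < X](bigD1 i) //=; apply: ltr_leD.
    by rewrite (lt_leif (tangent i)).
  by apply: ler_sum => j _; apply: tangent.
have -> : \sum_j (psi (absz (mu 0%R j)))%:Z * (mu 0 j - g 0 j) =
    - \sum_j (B ^ (K - absz (mu 0%R j)))%:Z * (g 0 j - mu 0 j).
  by rewrite -sumrN; apply: eq_bigr => j _; rewrite -mulrN opprB.
rewrite sumrB -!(big_morph Posz PoszD (erefl 0%:Z)); lia.
Qed.

Lemma dominated_shift mu g p : bounded_part K mu -> dominated mu g \/ g = mu ->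
  p \in Delta_plus l -> dominated mu (g + factor_shift K mu p).
Proof.
move=> [mub mumono] gP; rewrite inE => pP.
have sumE (w : 'I_l -> int) : \sum_i w i * ((g + factor_shift K mu p) 0 i - mu 0 i) =
    \sum_i w i * (g 0 i - mu 0 i) + \sum_i w i * factor_shift K mu p 0 i.
  by rewrite -big_split; apply: eq_bigr => i _; rewrite row_addE /= -mulrDr addrAC.
have [th rho] : \sum_i (B ^ (K - absz (mu 0%R i)))%:Z * (g 0 i - mu 0 i) <= 0 /\
    \sum_(i < l) i.+1%:Z * (g 0 i - mu 0 i) <= 0.
  case: gP => [[th rho]|->]; first by split=> //; apply: ltW.
  by split; rewrite big1 // => i _; rewrite subrr mulr0.
have psi_le : (B ^ (K - absz (mu 0%R p.1)) <= B ^ (K - absz (mu 0%R p.2)))%N.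
  rewrite leq_exp2l; last by lia.
  have := mumono _ _ (ltnW pP); have := mub p.1; have := mub p.2.
  by move: (mu _ _) (mu _ _) => a b; lia.
split; rewrite sumE sum_factor_shift.
  by move: psi_le th; set x := (B ^ _)%N; set y := (B ^ _)%N; case: ifP => _; lia.
by move: pP rho; move: (\sum_(i < l) _) => x; case: ifP => _; lia.
Qed.

(** The term without any shift is monic of the stated degree, and all the
    others have smaller degree. *)
Lemma closedK_hX_monic (mu : 'rV[int]_l) : bounded_part K mu ->
  closedK hX K mu mu \is monic /\
  size (closedK hX K mu mu) = (\sum_i e (absz (mu 0%R i))).+1.
Proof.
move=> muP; have [kmonic ksize] := kvec_of_hX_monic muP.1.
rewrite /closedK; set M := \sum_i _ in ksize *.
have : {subset enum (Delta_plus l) <= Delta_plus l} by move=> p; rewrite mem_enum.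
elim: (enum _) => [|p ps IH] psP; first by [].
have psP' : {subset ps <= Delta_plus l} by move=> q qps; apply: psP; rewrite inE qps orbT.
have [dmonic dsize] := IH psP'; rewrite map_cons fdiffs_cons.
set q := fdiffs _ _ (_ + _); have sq : (size (- q) < size (fdiffs
    [seq factor_shift K mu r | r <- ps] (@kvec_of _ hX l) mu))%N.
  rewrite size_polyN dsize ltnS.
  apply: (fdiffs_closed (P := dominated mu) (Q := fun x : {poly rat} => (size x <= M)%N)).
  - by move=> g; apply: size_kvec_of_dominated.
  - move=> x y xM yM; apply: leq_trans (size_polyD _ _) _.
    by rewrite size_polyN geq_max xM.
  - by move=> v g /mapP[r /psP' rP ->] gP; apply: dominated_shift; first by []; first by left.
  - by apply: dominated_shift => //; [right|apply: psP; rewrite mem_head].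
by rewrite monicE lead_coefDl // size_polyDl.
Qed.

End Triangular.

(** * Specialising the complete symmetric functions *)

(** The total degree of the subscript never increases, so only the [h_i] of
    index at most [D] occur. *)
Lemma closedK_rmorph (A C : comNzRingType) (f : {rmorphism A -> C}) (h : nat -> A)
    (h' : nat -> C) K l (d g : 'rV[int]_l) (D : nat) :
  (forall i, (i <= D)%N -> f (h i) = h' i) -> \sum_i g 0 i <= D%:Z ->
  f (closedK h K d g) = closedK h' K d g.
Proof.
move=> fh gD; rewrite /closedK fdiffs_raddf.
apply: (eq_fdiffs_in (P := fun g : 'rV[int]_l => \sum_i g 0 i <= D%:Z)) => //.
  move=> u uD; have [/forallP u0|] := boolP [forall i, 0 <= u 0 i]; last first.
    by case/forallPn => i; rewrite -ltNge => ui; rewrite /= !(kvec_of_neg _ ui) rmorph0.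
  rewrite /= /kvec_of rmorph_prod; apply: eq_bigr => i _.
  have uiD : u 0 i <= D%:Z.
    apply: le_trans uD; rewrite (bigD1 i) //= lerDl; apply: sumr_ge0 => j _.
    exact: u0.
  have := u0 i; case: (u 0 i) uiD => // a aD _; rewrite /kfun_of rmorph_sum.
  apply: eq_bigr => j _; rewrite rmorphMn fh //; lia.
move=> v u /mapP[p]; rewrite mem_enum inE => pD ->; apply: le_trans.
rewrite (_ : \sum_i (u + factor_shift K d p) 0 i =
  \sum_i u 0 i + \sum_i 1 * factor_shift K d p 0 i); last first.
  by rewrite -big_split; apply: eq_bigr => i _; rewrite row_addE mul1r.
by rewrite (sum_factor_shift _ (fun=> 1)) gerDl; case: ifP => _; rewrite ?subrr ?sub0r ?lerN10.
Qed.

(** The generating function of the complete symmetric functions, with the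
    geometric series truncated. *)
Lemma complete_gen_coef n (v : 'I_n -> algC) D d : (d <= D)%N ->
  (\prod_(i < n) \sum_(a < D.+1) (v i *: 'X) ^+ a : {poly algC})`_d =
  mmap ratr v (hsym n d).
Proof.
move=> dD; rewrite bigA_distr_bigA /= coef_sum /hsym raddf_sum /=.
have termE (f : {ffun 'I_n -> 'I_D.+1}) :
    (\prod_i (v i *: 'X) ^+ f i : {poly algC})`_d =
    if (\sum_(i < n) f i)%N == d then \prod_i v i ^+ f i else 0.
  under eq_bigr do rewrite exprZn.
  rewrite scaler_prod coefZ prodrXr coefXn eq_sym.
  by case: eqP => _; rewrite ?mulr1 ?mulr0.
under eq_bigr do rewrite termE.
rewrite -big_mkcond /=.
have m0P : (mdeg (0%MM : 'X_{1..n}) < d.+1)%N by rewrite mdeg0.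
pose to_m (f : {ffun 'I_n -> 'I_D.+1}) : 'X_{1..n < d.+1} :=
  insubd (BMultinom m0P) [multinom (f i : nat) | i < n].
pose to_f (m : 'X_{1..n < d.+1}) : {ffun 'I_n -> 'I_D.+1} :=
  [ffun i => inord (m i)].
have mle (m : 'X_{1..n < d.+1}) i : (m i < D.+1)%N.
  apply: leq_ltn_trans (_ : mdeg m < _)%N; last first.
    by apply: leq_trans (bmdeg m) _.
  by rewrite mdegE (bigD1 i) //= leq_addr.
have to_mE (f : {ffun 'I_n -> 'I_D.+1}) : (\sum_(i < n) f i)%N == d -> to_m f = [multinom (f i : nat) | i < n] :> 'X_{1..n}.
  move=> /eqP fd; rewrite /to_m insubdK // -topredE /= mdegE.
  by under eq_bigr do rewrite mnmE; rewrite fd.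
rewrite (reindex_onto to_f to_m); last first.
  move=> f fd; apply/ffunP => i; apply: val_inj; rewrite ffunE /= inordK ?mle //.
  by rewrite (to_mE f fd) mnmE.
have to_fE m i : to_f m i = m i :> nat by rewrite ffunE inordK ?mle.
apply: eq_big => [m|m _]; last first.
  by rewrite mmapX /mmap1; apply: eq_bigr => i _; rewrite to_fE.
rewrite mdegE; under eq_bigr do rewrite to_fE.
have [md|//] := eqVneq; rewrite /=; apply/eqP/val_inj; rewrite /= to_mE.
  by apply/mnmP => i; rewrite mnmE to_fE.
by under eq_bigr do rewrite to_fE; apply/eqP.
Qed.

(** With [N] the truncated generating series of [eta], a polynomial inverse
    [E] of [N] modulo ['X^(D.+1)] has constant term [1] and hence is a product
    of factors [1 - v_i 'X].  Modulo ['X^(D.+1)] its inverse is then both [N]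
    and the generating series of the [h_d (v)]. *)
Lemma hsym_specialize (eta : nat -> rat) D : eta 0%N = 1 ->
  exists n, exists v : 'I_n -> algC,
    forall d, (d <= D)%N -> mmap ratr v (hsym n d) = ratr (eta d).
Proof.
move=> eta0; pose N : {poly algC} := \poly_(d < D.+1) ratr (eta d).
pose E : {poly algC} := \sum_(i < D.+1) (1 - N) ^+ i.
have X1N : 'X %| 1 - N.
  rewrite -['X]subr0 dvdp_XsubCl rootE horner_coef0 coefB coef1 coef_poly /=.
  by rewrite subr_eq0 eta0 (rmorph1 (@ratr algC)).
have EN : 'X^(D.+1) %| 1 - E * N.
  have -> : 1 - E * N = (1 - N) ^+ D.+1.
    rewrite -[1 - E * N]opprK -[_ ^+ _ in RHS](subrK 1) subrX1 -/E; ring.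
  by rewrite dvdp_exp2r.
have E0 : E.[0] = 1.
  have : root (1 - E * N) 0.
    by rewrite root_factor_theorem subr0; apply: dvdp_trans EN; rewrite exprS dvdp_mulr.
  have : root (1 - N) 0 by rewrite root_factor_theorem subr0.
  rewrite /root !hornerE !subr_eq0 => /eqP <- /eqP; rewrite mulr1 => <-.
  by [].
have [r Er] := closed_field_poly_normal E.
have r0 z : z \in r -> z != 0.
  move=> zr; apply/eqP => z0; move: E0; rewrite Er hornerZ horner_prod.
  rewrite (big_rem z) //= z0 hornerXsubC subrr mul0r mulr0 => /eqP.
  by rewrite eq_sym oner_eq0.
pose v (i : 'I_(size r)) := (nth 0 r i)^-1.
have Ev : E = \prod_(i < size r) (1 - v i *: 'X).
  have fE : E = (lead_coef E * \prod_(i < size r) - nth 0 r i) *: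
      \prod_(i < size r) (1 - v i *: 'X).
    rewrite {1}Er -scalerA -scaler_prod (big_nth 0) big_mkord; congr (_ *: _).
    apply: eq_bigr => i _; rewrite scalerBr scalerA mulNr /v divff ?r0 ?mem_nth //.
    by rewrite scaleN1r opprK alg_polyC polyCN addrC.
  rewrite fE; suff -> : lead_coef E * \prod_(i < size r) - nth 0 r i = 1.
    by rewrite scale1r.
  have prod1 : \prod_(i < size r) (1 - v i *: 'X).[0] = 1.
    by apply: big1 => i _; rewrite !hornerE subr0.
  by move/(congr1 (horner^~ 0)): fE; rewrite E0 hornerZ horner_prod prod1 mulr1.
exists (size r), v => d dD; rewrite -(complete_gen_coef v dD).
set H := \prod_(i < _) _.
have EH : 'X^(D.+1) %| 1 - E * H.
  have -> : E * H = \prod_(i < size r) (1 - (v i *: 'X) ^+ D.+1).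
    rewrite Ev -big_split; apply: eq_bigr => i _ /=.
    by rewrite -[1 - _ ^+ _]opprK opprB subrX1 -mulNr opprB.
  apply: (big_ind (fun p => 'X^(D.+1) %| 1 - p)) => [|p q pX qX|i _].
  - by rewrite subrr dvdp0.
  - have -> : 1 - p * q = (1 - p) + p * (1 - q) by ring.
    by rewrite dvdp_add // dvdp_mull.
  - rewrite opprB addrCA subrr addr0 exprZn.
    by rewrite -mul_polyC dvdp_mull.
have : 'X^(D.+1) %| H - N.
  have -> : H - N = H * (1 - E * N) - N * (1 - E * H) by ring.
  by rewrite dvdp_sub // dvdp_mull.
case/dvdpP => q /(congr1 (fun p : {poly algC} => p`_d)).
rewrite coefMXn ltnS dD coefB coef_poly ltnS dD => /eqP.
by rewrite subr_eq0 => /eqP.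
Qed.

(** * Linear independence and uniqueness of the expansion *)

(** After the specialisation the functions become polynomials of distinct
    degrees.  Their combination vanishes at all natural numbers, hence is
    zero, and the coefficients vanish in order of decreasing degree. *)
Lemma closed_kschur_free K (S : seq (bpart K)) (c : bpart K -> rat) :
  uniq S ->
  (forall n, \sum_(mu <- S) c mu *: closed_kschur n K (val mu) = 0) ->
  forall mu, mu \in S -> c mu = 0.
Proof.
move=> uS S0; (* Every multiplicity of a part is then a digit in base [B]. *)
pose B := (\max_(mu <- S) size (val mu)).+3; have B3 : (2 < B)%N by [].
have sB (mu : bpart K) : mu \in S -> (size (val mu) < B)%N.
  move=> muS; rewrite ltnS 2?leqW //.
  exact: (leq_bigmax_seq (F := fun nu : bpart K => size (val nu))).
pose hX d : {poly rat} := 'X^(concave_exp B K d).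
pose w (mu : bpart K) := weight (size (val mu)) (nth 0%N (val mu)).
pose G mu := closedK hX K (w mu) (w mu).
pose Phi (mu : bpart K) := (\sum_(x <- val mu) concave_exp B K x)%N.
have wP mu : bounded_part K (w mu).
  have /andP[/allP muK mu_sorted] := valP mu; split=> [i|i j ij]; rewrite !mxE.
    by have := muK _ (mem_nth 0%N (ltn_ord i)); move: (nth _ _ _) => x; lia.
  have geq_trans : transitive geq by apply: rev_trans leq_trans.
  have := @sorted_leq_nth _ _ geq_trans leqnn 0%N _ mu_sorted i j.
  by rewrite !inE !ltn_ord => /(_ isT isT ij).
have [Gmonic Gsize] : (forall mu, G mu \is monic) /\ (forall mu, size (G mu) = (Phi mu).+1).
  have Gm mu := closedK_hX_monic B3 (wP mu); split=> mu; first by case: (Gm mu).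
  case: (Gm mu) => _ ->; rewrite /Phi (big_nth 0%N) big_mkord.
  by congr _.+1; apply: eq_bigr => i _; rewrite mxE.
have closedE n mu : closed_kschur n K (val mu) = closedK (hsym n) K (w mu) (w mu).
  rewrite (@closed_kschur_closedK _ _ 0) ?addn0; last first.
    by have /andP[/allP muK _] := valP mu; apply/allP => x /muK /andP[].
  by congr closedK; apply/rowP => i; rewrite !mxE addn0.
pose P := \sum_(mu <- S) c mu *: G mu.
(* The value of [P] at [t] is the image of the given relation under the
   specialisation [h_d = t ^ concave_exp d]. *)
have P_root (t : nat) : P.[t%:R] = 0.
  pose D := (\sum_(mu <- S) sumn (val mu))%N.
  pose eta d : rat := t%:R ^+ concave_exp B K d.
  have eta0 : eta 0%N = 1 by rewrite /eta /concave_exp subn0 subnn.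
  have [n [v vE]] := hsym_specialize D eta0.
  have wD mu : mu \in S -> \sum_i w mu 0 i <= D%:Z.
    move=> muS; rewrite (_ : \sum_i _ = (sumn (val mu))%:Z).
      by rewrite lez_nat /D (big_rem mu) //= leq_addr.
    rewrite sumnE (big_nth 0%N) big_mkord -natz natr_sum.
    by apply: eq_bigr => i _; rewrite mxE natz.
  apply: (fmorph_inj (@ratr algC)); rewrite rmorph0 -(rmorph0 (mmap (@ratr algC) v)) -(S0 n).
  rewrite /P horner_sum !rmorph_sum big_seq [RHS]big_seq; apply: eq_bigr => mu muS /=.
  rewrite hornerZ rmorphM mmapZ closedE; congr (_ * _).
  rewrite (closedK_rmorph K (w mu) vE (wD mu muS)).
  apply: (@closedK_rmorph _ _ ((@ratr algC) \o horner_eval (t%:R : rat)) hX _ K _ _ _ D) => //.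
    by move=> d _; rewrite /= /horner_eval hornerXn.
  exact: wD.
have P0 : P = 0.
  apply: (@roots_geq_poly_eq0 _ _ [seq i%:R | i <- iota 0 (size P)]).
  - by apply/allP => _ /mapP[i _ ->]; apply/eqP.
  - rewrite map_inj_uniq ?iota_uniq // => i j /eqP; rewrite eqr_nat => /eqP //.
  - by rewrite size_map size_iota.
pose M := \max_(mu <- S) Phi mu.
have PhiM mu : mu \in S -> (Phi mu <= M)%N by move=> muS; apply: leq_bigmax_seq.
move=> mu; have [N] := ubnP (M - Phi mu)%N; elim: N mu => // N IH mu muN muS.
have : P`_(Phi mu) = 0 by rewrite P0 coef0.
rewrite coef_sum (bigD1_seq mu) //= coefZ.
have -> : (G mu)`_(Phi mu) = 1.
  by have /monicP := Gmonic mu; rewrite lead_coefE Gsize.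
rewrite mulr1 big_seq_cond big1 ?addr0 // => nu /andP[nuS nu_mu]; rewrite coefZ.
have [lt|gt|eq] := ltngtP (Phi nu) (Phi mu).
- by rewrite nth_default ?mulr0 // Gsize.
- by rewrite IH ?mul0r //; have := PhiM nu nuS; lia.
- case/eqP: nu_mu; apply: val_inj; apply: (concave_exp_sum_inj B3 (valP nu) (valP mu)) => //.
    exact: sB.
  exact: sB.
Qed.

Lemma kschur_expansion_inj K (f : forall n, {mpoly rat[n]})
    (a b : {fsfun bpart K -> rat with 0}) :
  kschur_expansion f a -> kschur_expansion f b -> a = b.
Proof.
move=> fa fb; pose S := (finsupp a `|` finsupp b)%fset.
have sumS (x : {fsfun bpart K -> rat with 0}) n : (finsupp x `<=` S)%fset ->
    \sum_(mu <- finsupp x) x mu *: closed_kschur n K (val mu) =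
    \sum_(mu <- S) x mu *: closed_kschur n K (val mu).
  move=> xS; apply: big_fset_incl => // mu _; rewrite memNfinsupp => /eqP ->.
  by rewrite scale0r.
have S0 n : \sum_(mu <- S) (a mu - b mu) *: closed_kschur n K (val mu) = 0.
  under eq_bigr do rewrite scalerBl.
  by rewrite sumrB -!sumS ?fsubsetUl ?fsubsetUr // -fa -fb subrr.
apply/fsfunP => mu; have [muS|nmuS] := boolP (mu \in S).
  by apply/eqP; rewrite -subr_eq0 (closed_kschur_free (fset_uniq S) S0).
by move: nmuS; rewrite inE negb_or !memNfinsupp => /andP[/eqP -> /eqP ->].
Qed.

Theorem theorem1p4 (k l : nat) (lam : l.-tuple nat)
    (k_gt0 : (0 < k)%N) (lamP : in_sP k lam) :
  exists a : {fsfun bpart k.+1 -> rat with 0},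
    unique (kschur_expansion (fun n => closed_kschur n k lam)) a /\
    forall mu : bpart k.+1,
      (-1) ^ ((sumn lam)%:Z - (sumn (val mu))%:Z) * a mu \is a Num.nat.
Proof.
have [a aP apos] := kschur_expansion_exists lamP.
by exists a; split=> //; split=> // b; apply: kschur_expansion_inj.
Qed.
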